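(* Let $\Psi\subset\mathrm{Int}\,\mathbb{A}$ be an essential cofrontier and let $h:C\to C$ be a minimal homeomorphism of a Cantor set $C$. Then the pseudo-suspension $\Psi_C$ of $h$ is a continuum. If additionally $\Psi$ is the pseudo-circle, then every proper subcontinuum of $\Psi_C$ is a pseudo-arc and consequently $\Psi_C$ is hereditarily indecomposable.
   Context: $\mathbb{A}=[0,1]\times\mathbb{R}/\mathbb{Z}$ with universal covering $q:[0,1]\times\mathbb{R}\to\mathbb{A}$, $q(s,r)=(s,r+\mathbb{Z})$. A cofrontier is a planar continuum whose complement is the union of two connected open sets, each having the continuum as its boundary; $\Psi\subset\mathrm{Int}\,\mathbb{A}$ is essential if $\mathbb{A}\setminus\Psi$ has two components each containing a different boundary component of $\mathbb{A}$. Let $([0,1]\times\mathbb{R})_C$ be the quotient of $[0,1]\times\mathbb{R}\times C$ by the relation $((s,r),c)\approx((s',r'),c')$ iff $s=s'$ and there is $n\in\mathbb{Z}$ with $r'=r+n$ and $c'=h^{-n}(c)$, and let $q_C:([0,1]\times\mathbb{R})_C\to\mathbb{A}$ be $q_C([(s,r),c])=q(s,r)$. The pseudo-suspension of $h$ is $\Psi_C=q_C^{-1}(\Psi)$. A proper subcontinuum is a subcontinuum that is neither the whole space nor a single point. The pseudo-circle is Bing's hereditarily indecomposable circularly chainable planar continuum; the pseudo-arc is the chainable hereditarily indecomposable continuum. *)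

(* Defs.v *)
From HB Require Import structures.
From mathcomp Require Import all_boot all_order all_algebra.
From mathcomp Require Import all_classical all_reals all_analysis.
From mathcomp Require Import zify.

Set Implicit Arguments.
Unset Strict Implicit.
Unset Printing Implicit Defensive.

Import Order.TTheory GRing.Theory Num.Theory.
Import numFieldNormedType.Exports.
Local Open Scope classical_set_scope.
Local Open Scope ring_scope.

(* A subset is given the subspace topology; a set open in K is U `&` K for  *)
(* U open in T.                                                             *)

Definition metrizable_set (R : realType) {T : topologicalType} (K : set T) :=
  exists d : T -> T -> R,
    [/\ (forall x y, K x -> K y -> 0 <= d x y),
        (forall x y, K x -> K y -> (d x y = 0 <-> x = y)),
        (forall x y, K x -> K y -> d x y = d y x),
        (forall x y z, K x -> K y -> K z -> d x z <= d x y + d y z) &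
        (* d induces the subspace topology of K *)
        (forall x, K x -> forall A : set T,
           (exists U, [/\ open U, U x & U `&` K `<=` A]) <->
           (exists2 e : R, 0 < e & [set y | K y /\ d x y < e] `<=` A))].

Definition continuum (R : realType) {T : topologicalType} (K : set T) :=
  [/\ K !=set0, compact K, connected K & metrizable_set R K].

Definition subcontinuum (R : realType) {T : topologicalType} (X K : set T) :=
  K `<=` X /\ continuum R K.

Definition nondegenerate {T : Type} (K : set T) := ~ exists x, K = [set x].

Definition proper_subcontinuum (R : realType) {T : topologicalType}
  (X K : set T) := [/\ subcontinuum R X K, K <> X & nondegenerate K].

Definition indecomposable (R : realType) {T : topologicalType} (X : set T) :=
  ~ exists A B, [/\ proper_subcontinuum R X A, proper_subcontinuum R X B &
                    X = A `|` B].

Definition hereditarily_indecomposable (R : realType) {T : topologicalType}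
  (X : set T) :=
  forall K, subcontinuum R X K -> indecomposable R K.

Definition nat_adj (i j : nat) := (i <= j.+1)%N && (j <= i.+1)%N.

Definition refining_cover {T : topologicalType} (K : set T) (V : set (set T))
  (n : nat) (U : nat -> set T) :=
  [/\ (forall i, open (U i)),
      K `<=` \bigcup_(i in [set i | (i < n)%N]) U i &
      (forall i, (i < n)%N -> exists2 W, V W & U i `&` K `<=` W)].

Definition chainable {T : topologicalType} (K : set T) :=
  forall V : set (set T), (forall W, V W -> open W) ->
    K `<=` \bigcup_(W in V) W ->
    exists n (U : nat -> set T), refining_cover K V n U /\
      forall i j, (i < n)%N -> (j < n)%N ->
        (U i `&` U j `&` K !=set0 <-> nat_adj i j).

Definition circularly_chainable {T : topologicalType} (K : set T) :=
  forall V : set (set T), (forall W, V W -> open W) ->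
    K `<=` \bigcup_(W in V) W ->
    exists n (U : nat -> set T), refining_cover K V n U /\
      forall i j, (i < n)%N -> (j < n)%N ->
        (U i `&` U j `&` K !=set0 <->
         [\/ nat_adj i j, (i == 0)%N && (j == n.-1) | (j == 0)%N && (i == n.-1)]).

Definition is_pseudo_arc (R : realType) {T : topologicalType} (K : set T) :=
  [/\ continuum R K, nondegenerate K, chainable K &
      hereditarily_indecomposable R K].

Section Plane.
Variable R : realType.

(* q : [0,1] x R -> A, realized in the plane as the round annulus 1<=|z|<=2 *)
Definition qA (s r : R) : R * R :=
  ((1 + s) * cos (2 * pi * r), (1 + s) * sin (2 * pi * r)).

Definition annulus : set (R * R) :=
  [set z | exists s r, 0 <= s <= 1 /\ z = qA s r].
Definition annulus_int : set (R * R) :=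
  [set z | exists s r, 0 < s < 1 /\ z = qA s r].
Definition annulus_in_bd : set (R * R) := [set z | exists r, z = qA 0 r].
Definition annulus_out_bd : set (R * R) := [set z | exists r, z = qA 1 r].

Definition cofrontier (Psi : set (R * R)) :=
  continuum R Psi /\
  exists U V : set (R * R),
    [/\ open U /\ open V, connected U /\ connected V, U `&` V = set0,
        ~` Psi = U `|` V &
        closure U `\` U = Psi /\ closure V `\` V = Psi].

Definition essential (Psi : set (R * R)) :=
  Psi `<=` annulus_int /\
  let D := annulus `\` Psi in
  exists x0 x1,
    [/\ annulus_in_bd `<=` connected_component D x0,
        annulus_out_bd `<=` connected_component D x1,
        connected_component D x0 <> connected_component D x1 &
        D = connected_component D x0 `|` connected_component D x1].

Definition is_pseudo_circle (Psi : set (R * R)) :=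
  [/\ continuum R Psi, hereditarily_indecomposable R Psi,
      circularly_chainable Psi & ~ connected (~` Psi)].

End Plane.

Record homeo (C : topologicalType) := Homeo {
  hfun : C -> C;
  hinv : C -> C;
  hfunK : cancel hfun hinv;
  hinvK : cancel hinv hfun;
  hfun_cont : continuous hfun;
  hinv_cont : continuous hinv }.

Definition hpow {C : topologicalType} (h : homeo C) (n : int) : C -> C :=
  match n with
  | Posz k => iter k (hfun h)
  | Negz k => iter k.+1 (hinv h)
  end.

Definition minimal {C : topologicalType} (h : homeo C) :=
  forall A : set C, closed A -> hfun h @` A = A -> A = set0 \/ A = setT.

Section HpowLemmas.
Context {C : topologicalType} (h : homeo C).

Lemma hpowS (n : int) x : hpow h (1 + n) x = hfun h (hpow h n x).
Proof.
case: n => [k|k].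
  by have -> : 1 + Posz k = Posz k.+1 by lia.
case: k => [|k].
  have -> : 1 + Negz 0 = Posz 0 by rewrite NegzE; lia.
  by rewrite /= hinvK.
have -> : 1 + Negz k.+1 = Negz k by rewrite !NegzE; lia.
by rewrite /= hinvK.
Qed.

Lemma hpowN1 (n : int) x : hpow h (- 1 + n) x = hinv h (hpow h n x).
Proof.
case: n => [k|k].
  case: k => [|k]; first by [].
  have -> : - 1 + Posz k.+1 = Posz k by lia.
  by rewrite /= hfunK.
have -> : - 1 + Negz k = Negz k.+1 by rewrite !NegzE; lia.
by [].
Qed.

Lemma hpow0 x : hpow h 0 x = x. Proof. by []. Qed.

Lemma hpowD (m n : int) x : hpow h (m + n) x = hpow h m (hpow h n x).
Proof.
elim/int_rect: m => [|k IH|k IH]; first by rewrite add0r.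
  have -> : Posz k.+1 + n = 1 + (Posz k + n) by lia.
  rewrite hpowS IH.
  have -> : Posz k.+1 = 1 + Posz k by lia.
  by rewrite hpowS.
have -> : - (Posz k.+1) + n = - 1 + (- Posz k + n) by lia.
rewrite hpowN1 IH.
have -> : - Posz k.+1 = - 1 + - Posz k by lia.
by rewrite hpowN1.
Qed.

End HpowLemmas.

Section PseudoSuspension.
Variables (R : realType) (C : pseudoMetricType R) (h : homeo C).

Definition unit_interval : set R := `[0, 1]%classic.

Definition PST := ((set_type unit_interval * R) * C)%type.

Definition ps_rel_prop (x y : PST) : Prop :=
  x.1.1 = y.1.1 /\
  exists n : int, y.1.2 = x.1.2 + n%:~R /\ y.2 = hpow h (- n) x.2.

Definition ps_rel : rel PST := fun x y => `[< ps_rel_prop x y >].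

Lemma ps_rel_refl : reflexive ps_rel.
Proof.
move=> x; apply/asboolP; split => //; exists 0; split.
  by rewrite addr0.
by [].
Qed.

Lemma ps_rel_sym : symmetric ps_rel.
Proof.
move=> x y; apply/asboolP/asboolP => -[e [n [h1 h2]]]; split => //;
  exists (- n); split.
- by rewrite h1 mulrNz addrK.
- by rewrite opprK h2 -hpowD addrN.
- by rewrite h1 mulrNz addrK.
- by rewrite opprK h2 -hpowD addrN.
Qed.

Lemma ps_rel_trans : transitive ps_rel.
Proof.
move=> y x z /asboolP [e1 [n [h1 h2]]] /asboolP [e2 [m [h3 h4]]].
apply/asboolP; split; first by rewrite e1.
exists (n + m); split.
  by rewrite h3 h1 mulrzDr addrA.
by rewrite h4 h2 -hpowD opprD addrC.
Qed.

Canonical ps_equiv := EquivRel ps_rel ps_rel_refl ps_rel_sym ps_rel_trans.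

Local Open Scope quotient_scope.

Definition PSQ : topologicalType := quotient_topology {eq_quot ps_equiv}.

(* q_C : ([0,1] x R)_C -> A,  q_C [(s,r),c] = q(s,r) *)
Definition qC (x : PSQ) : R * R :=
  let y := (repr x : PST) in qA (val y.1.1) y.1.2.

Definition pseudo_suspension (Psi : set (R * R)) : set PSQ := qC @^-1` Psi.

End PseudoSuspension.

(* Main.v *)
Require Import Defs.
From HB Require Import structures.
From mathcomp Require Import all_boot all_order all_algebra.
From mathcomp Require Import all_classical all_reals all_analysis.
From mathcomp Require Import zify ring lra.

Set Implicit Arguments.
Unset Strict Implicit.
Unset Printing Implicit Defensive.

Import Order.TTheory GRing.Theory Num.Theory.
Import numFieldNormedType.Exports.
Local Open Scope classical_set_scope.
Local Open Scope ring_scope.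

(** Let [lft Psi] be the lift of [Psi] to the strip [0,1] x R and write x + n for
the translates of x.

Connectedness: a locally constant map E on [lft Psi] whose fibres are permuted by
x |-> x + 1 is constant. On a fine grid of the strip, label the vertices near
[lft Psi] by E and the others by the side of [Psi] they lie on. For every value e,
the signed number of times a horizontal row passes from the inner side to the
label e does not depend on the row, hence neither on e, since [Psi] is connected and
so the values of E form one orbit; as these numbers add up to 1, there is only one
value. Applied to E(x) = {c | (x,c) in B}, for B clopen in the suspension,
minimality of h gives that the suspension is connected. Applied to sheet numbers it
shows that a circular chain of [Psi] winds once around the annulus, so it unrolls to
a chain of [lft Psi] indexed by the integers.

Proper subcontinua: if K misses a box around (y,d), minimality makes every leaf
[lft Psi] x {c} return to that box in both directions, and the unrolled chain is cut
there; thus K is a copy of a continuum B in a single leaf. Unrolled chains make B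
chainable. Finally B does not project onto [Psi]: otherwise B would be saturated
(it would contain the lift, through each of its points, of every proper subcontinuum
of [Psi]), and the last nonempty intersection of B with a translate would be a
saturated set whose translates tile [lft Psi], against the first paragraph. Hence
continua in [lft Psi] that meet are nested, as in [Psi]. *)

(** * Connected sets and continua *)

Section Connectedness.
Context {T : topologicalType}.
Implicit Types A F : set T.

Lemma connected_closed_split A F1 F2 : connected A -> closed F1 -> closed F2 ->
  A `<=` F1 `|` F2 -> A `&` F1 `&` F2 = set0 -> A `<=` F1 \/ A `<=` F2.
Proof.
move=> cA c1 c2 AF dis; have [ne|/nonemptyPn e] := pselect (A `&` F1 !=set0).
  left; have <- : A `&` F1 = A; last by move=> x [].
  apply: cA => //; last by exists F1.
  exists (~` F2); first exact: closed_openC.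
  apply/seteqP; split=> x [Ax Fx]; split => //; last by case: (AF _ Ax).
  by move=> F2x; have : set0 x by rewrite -dis.
right=> x Ax; case: (AF _ Ax) => // F1x.
by have : set0 x by rewrite -e.
Qed.

Lemma connected_open_split A F1 F2 : connected A -> open F1 -> open F2 ->
  A `<=` F1 `|` F2 -> A `&` F1 `&` F2 = set0 -> A `<=` F1 \/ A `<=` F2.
Proof.
move=> cA o1 o2 AF dis.
have sub : A `<=` ~` F2 \/ A `<=` ~` F1.
  apply: connected_closed_split => //; [exact: open_closedC|exact: open_closedC| |].
    move=> x Ax; have [F2x|] := pselect (F2 x); last by left.
    by right=> F1x; have : set0 x by rewrite -dis.
  by apply/seteqP; split=> // x [[Ax nF2] nF1]; case: (AF _ Ax).
by case: sub => s; [left|right] => x Ax; case: (AF _ Ax) => // Fx; case: (s _ Ax).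
Qed.

End Connectedness.

Lemma connected_inj_image {T U : topologicalType} (f : T -> U) (B : set T) :
  hausdorff_space U -> {in B, continuous f} -> {in B &, injective f} ->
  hausdorff_space T -> compact B -> connected (f @` B) -> connected B.
Proof.
move=> hU cf fi hT cB cfB D D0 [C1 oC1 DE1] [C2 cC2 DE2].
have cptI (G : set T) : closed G -> compact (f @` (B `&` G)).
  move=> cG; apply: continuous_compact; last exact: compact_closedI.
  apply: continuous_in_subspaceT => x /set_mem[Bx _].
  by apply: cf; exact/mem_set.
have c1 : closed (f @` (B `&` C2)) by apply: compact_closed => //; exact: cptI.
have c2 : closed (f @` (B `&` ~` C1)).
  by apply: compact_closed => //; apply: cptI; exact: open_closedC.
have cov : f @` B `<=` f @` (B `&` C2) `|` f @` (B `&` ~` C1).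
  move=> _ [x Bx <-]; have [C1x|nC1x] := pselect (C1 x); last by right; exists x.
  have : (B `&` C2) x by rewrite -DE2 DE1.
  by left; exists x.
have dis : f @` B `&` f @` (B `&` C2) `&` f @` (B `&` ~` C1) = set0.
  rewrite -subset0 => _ [[_ [x [Bx C2x] <-]] [y [By nC1y]]] /fi yx.
  apply: nC1y; rewrite yx; [|exact/mem_set|exact/mem_set].
  have : (B `&` C2) x by [].
  by rewrite -DE2 DE1 => -[].
have [s|s] := connected_closed_split cfB c1 c2 cov dis.
  rewrite eqEsubset; split; first by rewrite DE1 => x [].
  move=> x Bx; have /s[y [By C2y] /fi yx] : (f @` B) (f x) by exists x.
  by rewrite DE2 -yx//; exact/mem_set.
case: D0 => x; rewrite DE1 => -[Bx C1x].
have /s[y [By nC1y] /fi yx] : (f @` B) (f x) by exists x.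
by case: nC1y; rewrite yx//; exact/mem_set.
Qed.

(** * Components of compact sets and boundary bumping *)

Section Bumping.
Context {R : realType} {T : pseudoMetricType R}.
Hypothesis hT : hausdorff_space T.

Let relclopen (K : set T) (x : T) : set (set T) :=
  [set H | [/\ closed H, H `<=` K, closed (K `\` H) & H x]].

(** The relatively clopen sets around [x] are stable under finite intersection. If all of them met
    [F], their traces on [F] would generate a proper filter on [K], and a cluster point would lie in
    [F] and in every one of them. *)
Let quasi_sep (K F : set T) (x : T) : compact K -> K x -> closed F ->
  (forall y, (forall H, relclopen K x H -> H y) -> ~ F y) ->
  exists2 H, relclopen K x H & H `&` F = set0.
Proof.
move=> cK Kx cF QF; apply: contrapT => nex.
have clK : closed K by exact: compact_closed.
pose G := filter_from (relclopen K x) (fun H => H `&` F).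
have FG : ProperFilter G.
  apply: filter_from_proper; last first.
    move=> H rH; apply: contrapT => /nonemptyPn e.
    by apply: nex; exists H.
  apply: filter_from_filter.
    by exists K; split => //; rewrite setDv; exact: closed0.
  move=> H1 H2 [c1 s1 k1 x1] [c2 s2 k2 x2]; exists (H1 `&` H2).
    split => //; [exact: closedI|by move=> y [/s1]|].
    by rewrite setDIr; exact: closedU.
  by move=> y [[? ?] ?].
have GK : G K.
  exists K; last by move=> ? [].
  by split => //; rewrite setDv; exact: closed0.
have [p [Kp clp]] := cK G FG GK.
have pH H : relclopen K x H -> closure (H `&` F) p.
  by move=> rH W Wp; apply: clp => //; exists H.
apply: (QF p).
  move=> H rH; case: (rH) => cH _ _ _; apply: cH.
  by apply: closureS (pH _ rH) => ? [].
apply: cF; apply: closureS (pH K _) => [? []//|].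
by split => //; rewrite setDv; exact: closed0.
Qed.

(* The quasi-component of [x] in [K] is connected: a clopen splitting of it
   would, by normality, extend to a clopen splitting of [K]. *)
Lemma component_sep (K F : set T) (x : T) : compact K -> K x -> closed F ->
  (forall y, connected_component K x y -> ~ F y) ->
  exists H, [/\ closed H, H `<=` K, closed (K `\` H), H x & H `&` F = set0].
Proof.
move=> cK Kx cF QF.
have clK : closed K by exact: compact_closed.
pose Q := [set y | forall H, relclopen K x H -> H y].
have QK : Q `<=` K.
  by move=> y; apply; split => //; rewrite setDv; exact: closed0.
have Qx : Q x by move=> H [].
have clQ : closed Q.
  move=> y cy H rH; case: (rH) => cH _ _ _; apply: cH.
  by apply: closureS cy => z; apply.
have [H [? ? ? ?] ?] : exists2 H, relclopen K x H & H `&` F = set0; last by exists H.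
apply: quasi_sep => // y Qy; apply: QF; exists Q => //; split => //.
move=> B B0 [C1 oC1 BE1] [C2 cC2 BE2].
have cB : closed B by rewrite BE2; exact: closedI.
have cB' : closed (Q `&` ~` C1) by apply: closedI => //; exact: open_closedC.
have dis : B `&` (Q `&` ~` C1) = set0.
  by rewrite BE1 -subset0 => z [[_ ?] [_]].
have [U1 [U2 [oU1 oU2 BU1 BU2 U120]]] :=
  (iffLR (@normal_openP R T) pseudometric_normal) _ _ cB cB' dis.
have [H [cH HK cKH Hx] HU] :
    exists2 H, relclopen K x H & H `&` ~` (U1 `|` U2) = set0.
  apply: quasi_sep => //; first exact/open_closedC/openU.
  move=> z Qz; apply; have [C1z|nC1z] := pselect (C1 z).
    by left; apply: BU1; rewrite BE1.
  by right; apply: BU2.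
have HUz z : H z -> U1 z \/ U2 z.
  move=> Hz; apply: contrapT => nU.
  by have : set0 z by rewrite -HU.
have not12 z : U1 z -> U2 z -> False.
  by move=> ? ?; have : set0 z by rewrite -U120.
(* As [U] and [V] are disjoint and cover [H], the set [H] minus [V] is again relatively clopen
   around [x], so it contains the quasi-component [Q]. *)
have rcU (U V : set T) : open U -> open V -> U x ->
    (forall z, H z -> U z \/ V z) -> (forall z, U z -> V z -> False) ->
    Q `<=` U.
  move=> oU oV Ux HUV nUV z Qz.
  have [] : (H `\` V) z.
    apply: Qz; split.
    - by apply: closedI => //; exact: open_closedC.
    - by move=> w [/HK].
    - have -> : K `\` (H `\` V) = (K `\` H) `|` (H `&` ~` U).
        apply/seteqP; split=> w.
          move=> [Kw nHV]; have [Hw|] := pselect (H w); last by left.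
          right; split => // Uw; apply: nHV; split => //; exact: nUV.
        move=> [[Kw nHw]|[Hw nUw]]; split => //; first by case.
          exact: HK.
        by case=> _; case: (HUV _ Hw).
      by apply: closedU => //; apply: closedI => //; exact: open_closedC.
    - by split=> //; exact: nUV.
  by move=> Hz nVz; case: (HUV _ Hz).
case: (HUz _ Hx) => [U1x|U2x].
  rewrite eqEsubset; split; first by rewrite BE1 => z [].
  move=> z Qz; rewrite BE1; split => //; apply: contrapT => nC1z.
  apply: (not12 z); first exact: (rcU U1 U2).
  exact: BU2.
case: B0 => b Bb; case: (not12 b); first exact: BU1.
apply: (rcU U2 U1) => //; first by move=> z /HUz[]; [right|left].
  by move=> z /[swap]; exact: not12.
by move: Bb; rewrite BE1 => -[].
Qed.

(** If the component missed [F], a set clopen in [Y] and disjoint from [F] would contain it. Away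
    from [F] the set [Y] is open in [X], so that set would be clopen in the connected [X], forcing
    [Y = X]. *)
Lemma boundary_bumping (X Y F : set T) (x : T) : connected X -> compact Y ->
  closed F -> Y `<=` X -> Y <> X -> Y x ->
  (exists2 U, open U & Y `\` F = X `&` U) ->
  exists2 y, connected_component Y x y & F y.
Proof.
move=> cX cY cF YX YnX Yx [U oU YFE]; apply: contrapT => nex.
have [y Cy|H [cH HY cYH Hx HF]] := component_sep cY Yx cF.
  by move=> Fy; apply: nex; exists y.
apply: YnX; apply/seteqP; split => //.
suff HX : H = X by move=> z Xz; apply: HY; rewrite HX.
apply: cX; first by exists x.
  exists (U `&` ~` (Y `\` H)); first by apply: openI => //; exact: closed_openC.
  apply/seteqP; split=> z.
    move=> Hz; have : (Y `\` F) z.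
      split; first exact: HY.
      by move=> Fz; have : set0 z by rewrite -HF.
    by rewrite YFE => -[Xz Uz]; split => //; split => // -[].
  move=> [Xz [Uz nYH]]; apply: contrapT => nHz; apply: nYH; split => //.
  have : (Y `\` F) z by rewrite YFE.
  by case.
exists H => //; apply/seteqP; split=> z; last by case.
by move=> Hz; split => //; exact/YX/HY.
Qed.

End Bumping.

(** * Nested subcontinua and metrizability of compact sets *)

Section Continua.
Context {R : realType} {T : topologicalType}.
Implicit Types K X : set T.

Lemma metrizable_sub K X : K `<=` X -> metrizable_set R X -> metrizable_set R K.
Proof.
move=> KX [d [d0 dE dC dT dtop]]; exists d; split.
- by move=> *; apply: d0; exact: KX.
- by move=> *; apply: dE; exact: KX.
- by move=> *; apply: dC; exact: KX.
- by move=> *; apply: dT; exact: KX.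
move=> x Kx A; have Xx := KX _ Kx; split.
  move=> [U [oU Ux UA]].
  have [e e0 sub] : exists2 e : R, 0 < e & [set y | X y /\ d x y < e] `<=` U.
    by apply/(dtop x Xx U); exists U; split => // y [].
  exists e => // y [Ky dy]; apply: UA; split => //; apply: sub; split => //.
  exact: KX.
move=> [e e0 sub].
have [U [oU Ux UA]] : exists U, [/\ open U, U x &
    U `&` X `<=` [set y | X y /\ d x y < e]].
  by apply/(dtop x Xx); exists e.
exists U; split => // y [Uy Ky]; apply: sub; split => //.
by have [] := UA y (conj Uy (KX _ Ky)).
Qed.

Lemma subcontinuumI X K : continuum R X -> K `<=` X -> K !=set0 -> compact K ->
  connected K -> subcontinuum R X K.
Proof.
by move=> [_ _ _ mX] KX *; split => //; split => //; exact: metrizable_sub mX.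
Qed.

(** Otherwise the union of [P] and [Q] is a subcontinuum that splits into two proper ones; a
    one-point piece is excluded because it would lie in the other. *)
Lemma subcontinua_nested X P Q : continuum R X -> hereditarily_indecomposable R X ->
  subcontinuum R X P -> subcontinuum R X Q -> P `&` Q !=set0 ->
  P `<=` Q \/ Q `<=` P.
Proof.
move=> cX hX [PX [P0 cP oP mP]] [QX [Q0 cQ oQ mQ]] PQ.
apply: contrapT => /not_orP[nPQ nQP].
have PUX : P `|` Q `<=` X by rewrite subUset.
have sU : subcontinuum R X (P `|` Q).
  apply: subcontinuumI => //; [by case: P0 => p; exists p; left|exact: compactU|].
  exact: connectedU.
case: (sU) => _ [_ _ _ mU].
apply: (hX _ sU); exists P, Q; split => //.
- split; first by split => //; exact: subsetUl.
    by move=> e; apply: nQP; rewrite e; exact: subsetUr.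
  move=> [p e]; apply: nPQ; rewrite e => _ ->.
  by case: PQ => y [+ Qy]; rewrite e /= => <-.
- split; first by split => //; exact: subsetUr.
    by move=> e; apply: nPQ; rewrite e; exact: subsetUl.
  move=> [p e]; apply: nQP; rewrite e => _ ->.
  by case: PQ => y [Py +]; rewrite e /= => <-.
Qed.

(** A metric whose balls are neighbourhoods already induces the topology of a compact set: on the
    compact complement of an open neighbourhood of [x] in [K], the distance to [x] is bounded below
    by a positive number. *)
Lemma compact_metrizable (d : T -> T -> R) K :
  (forall x y, 0 <= d x y) -> (forall x y, d x y = 0 <-> x = y) ->
  (forall x y, d x y = d y x) -> (forall x y z, d x z <= d x y + d y z) ->
  (forall x e, 0 < e -> \forall y \near x, d x y < e) ->
  compact K -> metrizable_set R K.
Proof.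
move=> d0 dE dC dT dn cK; exists d; split => //.
move=> x Kx A; split; last first.
  move=> [e e0 sub]; have : nbhs x [set y | d x y < e] by exact: dn.
  rewrite nbhsE => -[U [oU Ux] UA].
  by exists U; split => // y [/UA dy Ky]; apply: sub.
move=> [U [oU Ux UA]].
have cKU : compact (K `\` U).
  by apply: compact_closedI => //; exact: open_closedC.
have [|e /= e0 eP] := (iffLR (compact_near_coveringP _) cKU) _ (0^'+)
    (fun e y => e <= d x y) _.
  move=> y [Ky nUy].
  have dpos : 0 < d x y.
    rewrite lt_neqAle d0 andbT; apply/eqP => /esym/dE xy.
    by apply: nUy; rewrite -xy.
  near=> y' e.
  have h1 : d y y' < d x y / 2 by near: y'; apply: dn; rewrite divr_gt0.
  have h2 : e < d x y / 2 by near: e; apply: nbhs_right_lt; rewrite divr_gt0.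
  have h3 := dT x y' y; rewrite (dC y' y) in h3.
  rewrite /=; lra.
exists (e / 2); first by rewrite divr_gt0.
move=> y [Ky dy]; apply: UA; split => //; apply: contrapT => nUy.
have := eP (e / 2); rewrite /= sub0r normrN gtr0_norm ?divr_gt0//.
move=> /(_ _ _ y (conj Ky nUy)); lra.
Unshelve. all: by end_near. Qed.

Lemma separating_hausdorff (d : T -> T -> R) :
  (forall x y, d x y = 0 <-> x = y) ->
  (forall x y, d x y = d y x) -> (forall x y z, d x z <= d x y + d y z) ->
  (forall x e, 0 < e -> \forall y \near x, d x y < e) ->
  hausdorff_space T.
Proof.
move=> dE dC dT dn x y clxy; apply/dE.
have d0 : 0 <= d x y.
  by have := dT x y x; have /dE -> : x = x by []; rewrite (dC y x); lra.
apply/eqP; rewrite eq_le d0 andbT leNgt; apply/negP => dpos.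
have h : 0 < d x y / 2 by rewrite divr_gt0.
have [z [/= xz yz]] := clxy _ _ (dn x _ h) (dn y _ h).
have := dT x z y; rewrite (dC z y); lra.
Qed.

End Continua.

Lemma lebesgue_number {R : realType} {T : pseudoMetricType R} (K : set T)
    (V : set (set T)) : compact K -> (forall W, V W -> open W) ->
  K `<=` \bigcup_(W in V) W ->
  exists2 e : R, 0 < e & forall x, K x -> exists2 W, V W & ball x e `<=` W.
Proof.
move=> cK oV KV.
have [|e /= e0 eP] := (iffLR (compact_near_coveringP _) cK) _ (0^'+)
    (fun e y => exists2 W, V W & ball y e `<=` W) _.
  move=> x /KV[W VW Wx].
  have := open_nbhs_nbhs (conj (oV _ VW) Wx).
  rewrite -nbhs_ballE => -[d /= d0 dW].
  have d2 : 0 < d / 2 by rewrite divr_gt0.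
  near=> y e.
  have h1 : ball x (d / 2) y by near: y; exact: nbhsx_ballx.
  have h2 : e <= d / 2 by apply: ltW; near: e; exact: nbhs_right_lt.
  exists W => // z yz; apply: dW.
  by rewrite [d]splitr; apply: (ball_triangle h1); exact: le_ball yz.
exists (e / 2); first by rewrite divr_gt0.
have := eP (e / 2); rewrite /= sub0r normrN gtr0_norm ?divr_gt0//; apply; lra.
Unshelve. all: by end_near. Qed.

(** * The covering of the annulus *)

Section Covering.
Context {R : realType}.
Implicit Types (x y z : R * R) (n m : int) (e : R).

Definition shift x n : R * R := (x.1, x.2 + n%:~R).
Definition qp x : R * R := qA x.1 x.2.
Definition strip : set (R * R) := [set x | 0 <= x.1 <= 1].

Lemma shift0 x : shift x 0 = x.
Proof. by case: x => a b; rewrite /shift /= addr0. Qed.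

Lemma shiftD x n m : shift (shift x n) m = shift x (n + m).
Proof. by rewrite /shift /= intrD addrA. Qed.

Lemma shiftK x n : shift (shift x n) (- n) = x.
Proof. by rewrite shiftD subrr shift0. Qed.

Lemma shiftNK x n : shift (shift x (- n)) n = x.
Proof. by rewrite shiftD addNr shift0. Qed.

Lemma ballR2P x e y :
  ball x e y <-> `|x.1 - y.1| < e /\ `|x.2 - y.2| < e.
Proof. by []. Qed.

Lemma ball_shift x e y n : ball (shift x n) e (shift y n) <-> ball x e y.
Proof. by rewrite !ballR2P /= opprD addrACA subrr addr0. Qed.

Lemma hausdorffR2 : hausdorff_space (R * R)%type.
Proof. exact: norm_hausdorff. Qed.

Lemma cos_intD (a : R) n : cos (2 * pi * (a + n%:~R)) = cos (2 * pi * a).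
Proof.
have nat_case (b : R) (k : nat) : cos (2 * pi * (b + k%:R)) = cos (2 * pi * b).
  elim: k b => [|k IH] b; first by rewrite addr0.
  have -> : 2 * pi * (b + k.+1%:R) = 2 * pi * (b + k%:R) + pi *+ 2 :> R.
    by rewrite -natr1 mulr2n; ring.
  by rewrite cosD2pi.
case: n => k; first exact: nat_case.
by rewrite NegzE mulrNz -[in RHS](subrK (k.+1%:R) a) nat_case.
Qed.

Lemma sin_intD (a : R) n : sin (2 * pi * (a + n%:~R)) = sin (2 * pi * a).
Proof.
have nat_case (b : R) (k : nat) : sin (2 * pi * (b + k%:R)) = sin (2 * pi * b).
  elim: k b => [|k IH] b; first by rewrite addr0.
  have -> : 2 * pi * (b + k.+1%:R) = 2 * pi * (b + k%:R) + pi *+ 2 :> R.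
    by rewrite -natr1 mulr2n; ring.
  by rewrite sinD2pi.
case: n => k; first exact: nat_case.
by rewrite NegzE mulrNz -[in RHS](subrK (k.+1%:R) a) nat_case.
Qed.

Lemma qp_shift x n : qp (shift x n) = qp x.
Proof. by rewrite /qp /qA /= cos_intD sin_intD. Qed.

(** For the fractional part [f] one has 1 - cos (2 pi f) = 2 sin (pi f)^2, which is positive when 0
    < f < 1. *)
Lemma cos_2pi_eq1 (u : R) : cos (2 * pi * u) = 1 -> exists n, u = n%:~R.
Proof.
move=> cu; pose n := Num.floor u; exists n.
have /andP[n1 n2] := @floor_itv R u.
rewrite -/n intrD in n1 n2.
pose f := u - n%:~R; have f1 : f < 1 by rewrite /f; lra.
have f0 : 0 <= f by rewrite /f; lra.
suff : f = 0 by rewrite /f; lra.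
apply/eqP; rewrite eq_le f0 andbT leNgt; apply/negP => fp.
have : cos (2 * pi * f) = 1.
  by rewrite -(cos_intD f n) -[RHS]cu /f subrK.
have -> : 2 * pi * f = (pi * f) *+ 2 by rewrite mulr2n; ring.
rewrite cos_mulr2n cos2sin2.
have : 0 < sin (pi * f).
  apply: sin_gt0_pi; rewrite mulr_gt0 ?pi_gt0//=.
  by rewrite -[ltRHS]mulr1 ltr_pM2l ?pi_gt0.
move=> sp; have : 0 < sin (pi * f) ^+ 2 by rewrite exprn_gt0.
rewrite mulr2n; lra.
Qed.

(** The sum of the squared coordinates recovers the radius, and the cosine of the difference of the
    angles is then 1. *)
Lemma qp_inj x y : strip x -> strip y -> qp x = qp y -> exists n, y = shift x n.
Proof.
case: x => s r; case: y => s' r' /andP[/= s0 s1] /andP[/= s0' s1'].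
rewrite /qp /qA /= => -[e1 e2].
have es : s = s'.
  have e : (1 + s) ^+ 2 = (1 + s') ^+ 2.
    have sq (t u : R) : (1 + t) ^+ 2 = ((1 + t) * cos u) ^+ 2 + ((1 + t) * sin u) ^+ 2.
      by rewrite !exprMn -mulrDr cos2Dsin2 mulr1.
    by rewrite (sq s (2 * pi * r)) (sq s' (2 * pi * r')) e1 e2.
  have : (s - s') * (2 + s + s') = 0 by move: e; rewrite !expr2; lra.
  move=> /eqP; rewrite mulf_eq0 => /orP[/eqP|/eqP]; lra.
subst s'; have sn : 1 + s != 0 by apply/eqP; lra.
have ec := mulfI sn e1; have ess := mulfI sn e2.
have [n hn] : exists n, r' - r = n%:~R.
  apply: cos_2pi_eq1; rewrite mulrBr cosB -ec -ess -!expr2.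
  exact: cos2Dsin2.
by exists n; rewrite /shift /= -hn addrC subrK.
Qed.

Lemma continuous_qp : continuous qp.
Proof.
move=> x.
have c1 : (1 + y.1) @[y --> x] --> 1 + x.1.
  by apply: cvgD; [exact: cvg_cst|exact: cvg_fst].
have c2 : (2 * pi * y.2) @[y --> x] --> 2 * pi * x.2.
  by apply: cvgM; [exact: cvg_cst|exact: cvg_snd].
apply: (@cvg_pair _ _ _ (nbhs x) (nbhs (qp x).1) (nbhs (qp x).2) _ _ _
  (fun y => (1 + y.1) * cos (2 * pi * y.2))
  (fun y => (1 + y.1) * sin (2 * pi * y.2))) => /=; apply: cvgM => //.
  by apply: continuous_cvg => //; exact: continuous_cos.
by apply: continuous_cvg => //; exact: continuous_sin.
Qed.

Lemma shift_unit x : exists n, 0 <= (shift x n).2 <= 1.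
Proof.
exists (- Num.floor x.2); rewrite /shift /= mulrNz.
have /andP[] := @floor_itv R x.2; rewrite intrD => n1 n2.
by apply/andP; split; lra.
Qed.

Definition box (a b : R) : set (R * R) := [set x | 0 <= x.1 <= 1 /\ a <= x.2 <= b].

Lemma compact_box a b : compact (box a b).
Proof.
have -> : box a b = `[0, 1]%classic `*` `[a, b]%classic.
  by apply/seteqP; split=> x /=; rewrite !in_itv.
by apply: compact_setX; exact: segment_compact.
Qed.

(** The points of one period lying outside all translates of the ball form a compact set [G]. Its
    image is closed and misses [qp x], so the complement of the image serves as [W]. *)
Lemma qp_open x e : strip x -> 0 < e -> exists W, [/\ open W, W (qp x) &
  forall y, strip y -> W (qp y) -> exists n, ball (shift x n) e y].
Proof.
move=> sx e0.
pose U := \bigcup_(n in [set: int]) ball (shift x n) e.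
have oU : open U by apply: bigcup_open => n _; exact: ball_open.
pose G := box 0 1 `&` ~` U.
have cG : compact G.
  by apply: compact_closedI; [exact: compact_box|exact: open_closedC].
have cqG : closed (qp @` G).
  apply: compact_closed; first exact: hausdorffR2.
  apply: continuous_compact => //; apply: continuous_subspaceT.
  exact: continuous_qp.
exists (~` (qp @` G)); split; first exact: closed_openC.
  move=> [g [[sg _] nU] qg]; have [n xn] := qp_inj sg sx qg.
  apply: nU; exists (- n) => //.
  by rewrite xn shiftK; exact: ballxx.
move=> y sy nG; have [n hn] := shift_unit y.
have [m bm] : exists m, ball (shift x m) e (shift y n).
  apply: contrapT => nm; apply: nG; exists (shift y n); last exact: qp_shift.
  by split; [split|move=> [m _ bm]; apply: nm; exists m].
by exists (m - n); apply/(ball_shift _ _ _ n); rewrite shiftD subrK.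
Qed.

Section Lift.
Variable Psi : set (R * R).

Definition lft : set (R * R) := [set x | strip x /\ Psi (qp x)].

Lemma lft_shift x n : lft (shift x n) <-> lft x.
Proof. by rewrite /lft /= qp_shift. Qed.

Lemma lft_strip x : lft x -> strip x. Proof. by case. Qed.

Lemma closed_lft : closed Psi -> closed lft.
Proof.
move=> cP; apply: closedI; last first.
  by apply: preimage_closed => // x _; exact: continuous_qp.
have -> : strip = @fst R R @^-1` `[0, 1]%classic.
  by apply/seteqP; split=> x /=; rewrite in_itv.
apply: preimage_closed; last exact: itv_closed.
by move=> x _; exact: cvg_fst.
Qed.

Lemma compact_lft a b : closed Psi -> compact (lft `&` [set x | a <= x.2 <= b]).
Proof.
move=> cP; have -> : lft `&` [set x | a <= x.2 <= b] = box a b `&` lft.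
  by apply/seteqP; split=> x /=; [move=> [[? ?] ?]|move=> [[? ?] [_ ?]]].
by apply: compact_closedI; [exact: compact_box|exact: closed_lft].
Qed.

Lemma bounded_compact_lft (a : R) (B : set (R * R)) : closed Psi -> closed B -> B `<=` lft ->
  (forall x, B x -> `|x.2| <= a) -> compact B.
Proof.
move=> cP cB Bl Ba; apply: subclosed_compact cB (@compact_lft (- a) a cP) _.
by move=> x Bx; split; [exact: Bl|rewrite /= -ler_norml; exact: Ba].
Qed.

Lemma lft_unit x : lft x -> exists n, lft (shift x n) /\ 0 <= (shift x n).2 <= 1.
Proof.
by move=> lx; have [n hn] := shift_unit x; exists n; split=> //; exact/lft_shift.
Qed.

End Lift.

Lemma compact_bounded2 (B : set (R * R)) : compact B ->
  exists k : nat, forall x, B x -> `|x.2| <= k%:R.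
Proof.
move=> cB.
have cf : compact (snd @` B).
  apply: continuous_compact => //; apply: continuous_subspaceT => x.
  exact: cvg_snd.
have [M [_ HM]] := compact_bounded cf.
exists (Num.bound (`|M| + 1)) => x Bx.
apply: le_trans (ltW (archi_boundP _)); last by rewrite addr_ge0.
by apply: (HM (`|M| + 1)); [have := ler_norm M; lra|exists x].
Qed.

Lemma continuous_shift n : continuous (shift^~ n).
Proof.
move=> x; apply: (@cvg_pair _ _ _ (nbhs x) (nbhs x.1) (nbhs (x.2 + n%:~R)) _ _ _
  fst (fun y => y.2 + n%:~R)); first exact: cvg_fst.
by apply: cvgD; [exact: cvg_snd|exact: cvg_cst].
Qed.

End Covering.

(** * Crossing numbers on a grid *)

Section Grid.
Variable S : eqType.
Implicit Types (a b c d : bool + S) (e : S).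

(** Labels of grid vertices: [inl true] is the inner side of the cofrontier, [inl false] any other
    place off it, and [inr s] a vertex near the lift, with value [s]. *)
Definition isL a := if a is inl true then true else false.
Definition isB e a := if a is inr s then s == e else false.
(** The constraint between neighbouring vertices: distinct sides never touch, nor do distinct
    values, whereas a side and a value may be adjacent. *)
Definition compat a b :=
  match a, b with
  | inl x, inl y => x == y
  | inr s, inr t => s == t
  | _, _ => true
  end.

(* Signed crossing of the frontier between [inl true] and the value [e]. *)
Definition cross e a b : int :=
  (isL a && isB e b)%:Z - (isB e a && isL b)%:Z.

(** Among pairwise compatible labels at most one side and one value occur. If these are [inl true]
    and [inr e], then [cross e a b] is the difference of [isL a] and [isL b]; otherwise it vanishes.
    Either way it is independent of the path. *)
Lemma cross_square e a b c d : compat a b -> compat a c -> compat a d ->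
  compat b c -> compat b d -> compat c d ->
  cross e a b + cross e b d = cross e a c + cross e c d.
Proof.
case: a => [[]|a]; case: b => [[]|b]; case: c => [[]|c]; case: d => [[]|d] //=;
  rewrite /cross /=; intros;
  repeat match goal with H : is_true (?x == ?y) |- _ =>
    move/eqP in H; first [subst y | subst x | clear H] end;
  repeat match goal with |- context[?x == e] => destruct (x == e) end; 
  rewrite /=; lia.
Qed.

Variables (lab : nat -> nat -> bool + S) (M : nat).
Hypothesis lab0 : forall j, lab 0 j = inl true.
Hypothesis labM : forall j, lab M j = inl false.
Hypothesis labC : forall i j i' j', (i <= M)%N -> (i' <= M)%N ->
  nat_adj i i' -> nat_adj j j' -> compat (lab i j) (lab i' j').

Definition crossings e j := \sum_(0 <= i < M) cross e (lab i j) (lab i.+1 j).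

(** Squares are swept one by one between two consecutive rows. The vertical edges at both ends
    contribute nothing, because the labels there are constantly [inl true] and [inl false]. *)
Lemma crossingsS e j : crossings e j.+1 = crossings e j.
Proof.
have key k : (k <= M)%N ->
  \sum_(0 <= i < k) cross e (lab i j) (lab i.+1 j) + cross e (lab k j) (lab k j.+1)
  = \sum_(0 <= i < k) cross e (lab i j.+1) (lab i.+1 j.+1).
  elim: k => [|k IH] kM; first by rewrite !big_geq // !lab0.
  rewrite !big_nat_recr //= -IH ?(ltnW kM)// -[LHS]addrA -[RHS]addrA.
  congr (_ + _); apply: cross_square; apply: labC; rewrite ?(ltnW kM) //;
  by rewrite /nat_adj; lia.
have := key M (leqnn _); rewrite !labM /crossings => <-.
by have -> : cross e (inl false) (inl false) = 0 by []; rewrite addr0.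
Qed.

Lemma crossings0 e j : crossings e j = crossings e 0.
Proof. by elim: j => // j IH; rewrite crossingsS. Qed.

(** Let [l] list the values seen on row 0. All of them satisfy [P], so they share one crossing
    number, whose product with [size l] is the total 1; hence [l] has one entry. A value outside [l]
    has crossing number 0, which [P] then excludes. *)
Lemma labels_unique (P : S -> Prop) :
  (forall i s, lab i 0 = inr s -> P s) ->
  (forall e e', P e -> P e' -> crossings e 0 = crossings e' 0) ->
  forall e e', P e -> P e' -> e = e'.
Proof.
move=> labP cP.
pose val i := if lab i 0 is inr s then [:: s] else [::].
pose l := undup (flatten [seq val i | i <- iota 0 M.+1]).
have lval i s : (i <= M)%N -> lab i 0 = inr s -> s \in l.
  move=> iM ls; rewrite mem_undup; apply/flattenP; exists (val i).
    by apply: map_f; rewrite mem_iota; lia.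
  by rewrite /val ls inE.
have Pl s : s \in l -> P s.
  rewrite mem_undup => /flattenP[_ /mapP[i _ ->]]; rewrite /val.
  case E : (lab i 0) => [|t] //; rewrite inE => /eqP ->; exact: labP E.
have out e : e \notin l -> crossings e 0 = 0.
  move=> el; rewrite /crossings big_nat big1 // => i /andP[_ iM].
  have nB k : (k <= M)%N -> isB e (lab k 0) = false.
    move=> kM; case E : (lab k 0) => [|t] //=; apply/negbTE.
    by apply: contra el => /eqP <-; exact: lval E.
  by rewrite /cross !nB ?(ltnW iM)// andbF.
(* Summed over all values, the crossings of an edge from [a] to [b] give [isL a - isL b] by
   compatibility, and this telescopes from the inner to the outer end. *)
have tot : \sum_(e <- l) crossings e 0 = 1.
  rewrite /crossings exchange_big /=.
  have sumB i : (i <= M)%N ->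
      \sum_(e <- l) (isB e (lab i 0))%:Z = (if lab i 0 is inr _ then 1 else 0)%N.
    move=> iM; case E : (lab i 0) => [b|t] /=; first by rewrite big1.
    rewrite (bigD1_seq t) ?undup_uniq ?(lval i)//= eqxx big1 ?addr0// => s.
    by rewrite eq_sym => /negbTE ->.
  have step i : (i < M)%N ->
      \sum_(e <- l) cross e (lab i 0) (lab i.+1 0) =
      (isL (lab i 0))%:Z - (isL (lab i.+1 0))%:Z.
    move=> iM; rewrite /cross sumrB.
    have dl (b : bool) a : \sum_(e <- l) (b && isB e a)%:Z = b%:Z * \sum_(e <- l) (isB e a)%:Z.
      by rewrite big_distrr /=; apply: eq_bigr => s _; case: b; case: isB.
    under [X in _ - X]eq_bigr do rewrite andbC.
        rewrite !dl !sumB// ?(ltnW iM)//.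
    have := @labC i 0 i.+1 0 (ltnW iM) iM.
    rewrite /nat_adj => /(_ _ _).
    case: (lab i 0) => [[]|s]; case: (lab i.+1 0) => [[]|t] //= H; lia.
  rewrite big_nat (eq_bigr (fun i => (isL (lab i 0))%:Z - (isL (lab i.+1 0))%:Z)); last first.
    by move=> i /andP[_]; exact: step.
  rewrite -big_nat; under eq_bigr do rewrite -opprB.
  by rewrite sumrN telescope_sumr // lab0 labM.
move=> e e' Pe Pe'.
have cst : forall s, s \in l -> crossings s 0 = crossings e 0.
  by move=> s /Pl Ps; exact: cP.
have sz : (size l)%:Z * crossings e 0 = 1.
  rewrite -tot (eq_big_seq (fun=> crossings e 0)) // big_const_seq count_predT.
  by rewrite iter_addr_0 -mulr_natl natz.
have s1 : size l = 1%N.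
  by move/(congr1 absz)/eqP: sz; rewrite abszM muln_eq1 => /andP[/eqP].
have inl' s : P s -> s \in l.
  move=> Ps; apply: contraT => /out z; move: sz.
  by rewrite -(cP s e Ps Pe) z mulr0.
case: l s1 {lval Pl out tot cst sz} inl' => [|x [|]] //= _ H.
by have := H _ Pe; have := H _ Pe'; rewrite !inE => /eqP -> /eqP ->.
Qed.

End Grid.

(** * Equivariant locally constant maps *)

Section EquivariantlyConstant.
Context {R : realType}.
Variable Psi : set (R * R).
Hypotheses (cPsi : compact Psi) (coPsi : connected Psi).
Hypotheses (intPsi : Psi `<=` @annulus_int R) (essPsi : essential Psi).
Implicit Types x y z u v : R * R.

Let clPsi : closed Psi.
Proof. by apply: compact_closed => //; exact: hausdorffR2. Qed.

Lemma lft_int x : lft Psi x -> 0 < x.1 < 1.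
Proof.
move=> [sx /intPsi[s [r [/andP[s0 s1] qx]]]].
have [|n e] := @qp_inj _ x (s, r) sx _ qx; first by rewrite /strip /= !ltW.
by case: e => <- _; rewrite s0.
Qed.

Lemma Psi_lft z : Psi z -> exists2 x, lft Psi x & qp x = z.
Proof.
move=> Pz; have [s [r [/andP[s0 s1] qx]]] := intPsi Pz.
by exists (s, r) => //; split; [rewrite /strip /= !ltW|rewrite /qp /= -qx].
Qed.

(** A Lebesgue number for the one-element cover of a single period by the open strip gives the
    margin, and translations do not change the first coordinate. *)
Lemma lft_margin : exists2 e : R, 0 < e & forall x, lft Psi x -> e <= x.1 <= 1 - e.
Proof.
pose W : set (R * R) := [set x | 0 < x.1] `&` [set x | x.1 < 1].
have oW : open W.
  apply: openI.
    apply: (@open_comp _ _ fst [set a : R | 0 < a]); last exact: open_gt.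
    by move=> x _; exact: cvg_fst.
  apply: (@open_comp _ _ fst [set a : R | a < 1]); last exact: open_lt.
  by move=> x _; exact: cvg_fst.
have [_ ->//|x [lx _]|e e0 eP] := @lebesgue_number R _ _ [set W] (@compact_lft R Psi 0 1 clPsi).
  by exists W => //; apply/andP; exact: lft_int.
exists (e / 2); first by rewrite divr_gt0.
move=> x lx; have [n [ln un]] := lft_unit lx.
have [_ -> sub] := eP _ (conj ln un).
have [|a _] := sub (x.1 - e / 2, x.2 + n%:~R).
  apply/ballR2P; rewrite /= subrr normr0 opprB addrC subrK ger0_norm; lra.
have [|_ b] := sub (x.1 + e / 2, x.2 + n%:~R).
  apply/ballR2P; rewrite /= subrr normr0 opprD addrA subrr sub0r normrN ger0_norm; lra.
by move: a b => /=; lra.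
Qed.

Section Map.
Variables (S : Type) (E : R * R -> S).
Hypothesis Eloc : forall x, lft Psi x -> \forall y \near x, lft Psi y -> E y = E x.
Hypothesis Eeqv : forall x y, lft Psi x -> lft Psi y ->
  (E x = E y <-> E (shift x 1) = E (shift y 1)).

Let Eshift x y (n : int) : lft Psi x -> lft Psi y ->
  (E x = E y <-> E (shift x n) = E (shift y n)).
Proof.
have nat_case (k : nat) u v : lft Psi u -> lft Psi v ->
    (E u = E v <-> E (shift u k) = E (shift v k)).
  move=> lu lv; elim: k => [|k IH]; first by rewrite !shift0.
  rewrite IH Eeqv; [|exact/lft_shift|exact/lft_shift].
  by rewrite !shiftD -PoszD addn1.
case: n => k lx ly; first exact: nat_case.
rewrite NegzE; apply: iff_sym; rewrite (nat_case k.+1); [|exact/lft_shift|exact/lft_shift].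
by rewrite !shiftNK.
Qed.

Let Eclosed (P : S -> Prop) : closed [set x | lft Psi x /\ P (E x)].
Proof.
move=> x cx; have lx : lft Psi x.
  by apply: closed_lft => //; apply: closureS cx => y [].
split => //; have [y [[ly Py] Ey]] := cx _ (Eloc lx).
by rewrite -Ey.
Qed.

(* Psi is connected, so the values of E form a single orbit. *)
Let Eorbit x y : lft Psi x -> lft Psi y -> exists n, E y = E (shift x n).
Proof.
move=> lx ly; pose P s := exists n, s = E (shift x n).
pose G (Q : S -> Prop) := [set y | lft Psi y /\ Q (E y)] `&` box 0 1.
have cG Q : closed (qp @` G Q).
  apply: compact_closed; first exact: hausdorffR2.
  apply: continuous_compact; first by apply: continuous_subspaceT; exact: continuous_qp.
  by rewrite /G setIC; apply: compact_closedI; [exact: compact_box|exact: Eclosed].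
have PS u n : lft Psi u -> P (E u) -> P (E (shift u n)).
  move=> lu [m Em]; exists (m + n); rewrite -shiftD.
  by apply: (iffLR (Eshift n lu _)) => //; exact/lft_shift.
have cov : Psi `<=` qp @` G P `|` qp @` G (fun s => ~ P s).
  move=> z Pz; have [u lu <-] := Psi_lft Pz.
  have [n [ln un]] := lft_unit lu.
  have bn : box 0 1 (shift u n) by split => //; exact: lft_strip ln.
  by have [Pu|Pu] := pselect (P (E (shift u n))); [left|right];
    (exists (shift u n); last exact: qp_shift).
have [|s|s] := connected_closed_split coPsi (cG P) (cG (fun s => ~ P s)) cov.
- rewrite -subset0 => _ [[_ [u [[lu Pu] _] <-]]] [v [[lv Pv] _]] qvu.
  apply: Pv; have [n ->] := qp_inj (lft_strip lu) (lft_strip lv) (esym qvu).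
  exact: PS.
- have [u [[lu Pu] _] quy] := s _ ly.2.
  have [n ->] := qp_inj (lft_strip lu) (lft_strip ly) quy.
  exact: PS.
- have [u [[lu Pu] _] qux] := s _ lx.2.
  case: Pu; have [n ->] := qp_inj (lft_strip lx) (lft_strip lu) (esym qux).
  by exists n.
Qed.

(** One period of the lift is compact, so a Lebesgue number exists there; equivariance moves any
    other pair of points into that period. *)
Let Euniform : exists2 e : R, 0 < e & forall x y, lft Psi x -> lft Psi y ->
  ball x e y -> E x = E y.
Proof.
pose V : set (set (R * R)) := [set W | open W /\
  forall x y, lft Psi x -> lft Psi y -> W x -> W y -> E x = E y].
have [W []//|x [lx _]|e e0 eP] := @lebesgue_number R _ _ V (@compact_lft R Psi 0 1 clPsi).
  have : nbhs x [set y | lft Psi y -> E y = E x] by exact: Eloc.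
  rewrite nbhsE => -[W [oW Wx] WE]; exists W => //; split => // u v lu lv Wu Wv.
  by rewrite (WE u) // (WE v).
exists e => // x y lx ly bxy; have [n [ln un]] := lft_unit lx.
have [W [_ VW] sub] := eP _ (conj ln un).
apply: (iffRL (Eshift n lx ly)); apply: VW => //; first exact/lft_shift.
  by apply: sub; exact: ballxx.
by apply: sub; exact/ball_shift.
Qed.

Theorem equivariantly_constant x y : lft Psi x -> lft Psi y -> E x = E y.
Proof.
move=> lx ly.
have [d d0 dP] := Euniform.
have [m m0 mP] := lft_margin.
(* Vertices within [2 * eta] of the lift will carry values. Lift points chosen for neighbouring such
   vertices are then less than [5 * eta] apart, where [E] agrees, and [3 * eta <= m] keeps the two
   ends of each row away from the lift. *)
pose eta := Num.min (d / 5) (m / 3).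
have eta0 : 0 < eta by rewrite lt_min !divr_gt0.
have etad : 5 * eta <= d.
  have : eta <= d / 5 by rewrite ge_min lexx.
  lra.
have etam : 3 * eta <= m.
  have : eta <= m / 3 by rewrite ge_min lexx orbT.
  lra.
pose M := (Num.bound eta^-1).+1.
have M0 : 0 < M%:R :> R by rewrite ltr0n.
have Meta : M%:R^-1 < eta.
  rewrite -[ltRHS]invrK ltf_pV2 ?posrE ?invr_gt0//.
  apply: lt_trans (archi_boundP _) _; first by rewrite invr_ge0 ltW.
  by rewrite ltr_nat.
(* The index [i] runs across the annulus and [j] around it. With mesh [1 / M], advancing [j] by [M]
   is exactly the translation by 1. *)
pose gv (i j : nat) : R * R := (i%:R / M%:R, j%:R / M%:R).
have gvS i j : gv i (j + M)%N = shift (gv i j) 1.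
  by rewrite /gv /shift /= natrD mulrDl divff ?gt_eqF.
have gv_strip i j : (i <= M)%N -> strip (gv i j).
  move=> iM; rewrite /strip /= divr_ge0 //= ler_pdivrMr// mul1r.
  by rewrite ler_nat.
have gv_near1 (i i' : nat) : nat_adj i i' -> `|i%:R / M%:R - i'%:R / M%:R| < eta :> R.
  move=> /andP[h1 h2]; apply: le_lt_trans Meta.
  rewrite -mulrBl normrM [X in _ * X]ger0_norm; last by rewrite invr_ge0 ltW.
  rewrite -[leRHS]mul1r ler_pM2r ?invr_gt0// ler_norml.
  have : i%:R <= i'%:R + 1 :> R by rewrite natr1 ler_nat.
  have : i'%:R <= i%:R + 1 :> R by rewrite natr1 ler_nat.
  by move=> ? ?; apply/andP; split; lra.
pose black v := exists2 w, lft Psi w & ball v (2 * eta) w.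
pose npt v := xget v [set w | lft Psi w /\ ball v (2 * eta) w].
have nptP v : black v -> lft Psi (npt v) /\ ball v (2 * eta) (npt v).
  move=> [w lw bw]; rewrite /npt; apply: (@xgetPex _ v [set w | lft Psi w /\ ball v (2 * eta) w]).
  by exists w.
have blackS v : black v -> black (shift v 1).
  by move=> [w lw bw]; exists (shift w 1); [exact/lft_shift|exact/ball_shift].
have blackS' v : black (shift v 1) -> black v.
  move=> [w lw bw]; exists (shift w (-1)); first exact/lft_shift.
  by apply/(ball_shift _ _ _ 1); rewrite shiftNK.
case: essPsi => _ [x0 [x1 [in0 in1 n01 _]]].
set D := @annulus R `\` Psi in in0 in1 n01.
(* The values of [E] need a decidable equality to serve as labels. *)
pose S' : eqType := {classic S}.
pose lb v : bool + S' :=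
  if `[< black v >] then inr (E (npt v) : S')
  else inl `[< connected_component D x0 (qp v) >].
have lbB v : black v -> lb v = inr (E (npt v) : S').
  by move=> bv; rewrite /lb asboolT.
have lbW v : ~ black v -> lb v = inl `[< connected_component D x0 (qp v) >].
  by move=> bv; rewrite /lb asboolF.
have Enpt u v : black u -> black v -> `|u.1 - v.1| < eta -> `|u.2 - v.2| < eta ->
    E (npt u) = E (npt v).
  move=> /nptP[lu /ballR2P[u1 u2]] /nptP[lv /ballR2P[v1 v2]] h1 h2.
  apply: dP => //; apply/ballR2P.
  by move: u1 u2 v1 v2 h1 h2; rewrite !ltr_norml; lra.
(* Every point of the segment from [u] to [v] is closer to [u] than [2 * eta]. As [u] is not black,
   the segment misses the lift and projects to a connected subset of [D]. *)
have Wseg u v : strip u -> strip v -> ~ black u ->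
    `|u.1 - v.1| < eta -> `|u.2 - v.2| < eta ->
    connected_component D (qp u) (qp v).
  move=> su sv bu h1 h2.
  pose g (t : R) : R * R := (u.1 + t * (v.1 - u.1), u.2 + t * (v.2 - u.2)).
  have cg : continuous g.
    move=> t; apply: (@cvg_pair _ _ _ (nbhs t) (nbhs (g t).1) (nbhs (g t).2) _ _ _
      (fun t => u.1 + t * (v.1 - u.1)) (fun t => u.2 + t * (v.2 - u.2))).
      apply: cvgD; first exact: cvg_cst.
      by apply: cvgM; [exact: cvg_id|exact: cvg_cst].
    apply: cvgD; first exact: cvg_cst.
    by apply: cvgM; [exact: cvg_id|exact: cvg_cst].
  exists ((qp \o g) @` `[0, 1]%classic).
    split.
    - exists 0; first by rewrite /= in_itv /= lexx ler01.
      by rewrite /= /g !mul0r !addr0 -surjective_pairing.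
    - move=> _ [t /= + <-]; rewrite in_itv /= => /andP[t0 t1].
      have sg : strip (g t).
        move: su sv; rewrite /strip /= => /andP[? ?] /andP[? ?].
        by apply/andP; split; nra.
      split; first by exists (g t).1, (g t).2.
      move=> Pg; apply: bu; exists (g t) => //; apply/ballR2P => /=.
      rewrite !opprD !addrA !subrr !sub0r !normrN !normrM (ger0_norm t0).
      by rewrite distrC in h1; rewrite distrC in h2; split; nra.
    - apply: connected_continuous_connected; first exact: segment_connected.
      apply: continuous_subspaceT => t; apply: continuous_comp; first exact: cg.
      exact: continuous_qp.
  exists 1; first by rewrite /= in_itv /= lexx ler01.
  by rewrite /= /g !mul1r ![_ + (_ - _)]addrC !subrK -surjective_pairing.
pose lab i j := lb (gv i j).
have edge v : (v.1 = 0 \/ v.1 = 1) -> ~ black v.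
  move=> hv [w lw /ballR2P[b1 _]]; move: b1; have := mP _ lw.
  by case: hv => ->; rewrite ltr_norml => /andP[? ?] /andP[? ?]; lra.
have lab0 j : lab 0%N j = inl true.
  rewrite /lab lbW; last by apply: edge; left; rewrite /gv /= mul0r.
  by rewrite asboolT //; apply: in0; exists (gv 0 j).2; rewrite /qp /= mul0r.
have labM j : lab M j = inl false.
  rewrite /lab lbW; last by apply: edge; right; rewrite /gv /= divff ?gt_eqF.
  rewrite asboolF // => c0; apply: n01.
  rewrite (same_connected_component c0); apply/esym/same_connected_component.
  by apply: in1; exists (gv M j).2; rewrite /qp /= divff ?gt_eqF.
have labC i j i' j' : (i <= M)%N -> (i' <= M)%N ->
    nat_adj i i' -> nat_adj j j' -> compat (lab i j) (lab i' j').
  move=> iM iM' a1 a2; rewrite /lab.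
  have h1 := gv_near1 _ _ a1; have h2 := gv_near1 _ _ a2.
  have [b|b] := pselect (black (gv i j)); have [b'|b'] := pselect (black (gv i' j'));
    rewrite ?(lbB _ b) ?(lbW _ b) ?(lbB _ b') ?(lbW _ b') //=.
    by apply/eqP; exact: Enpt.
  apply/eqP; apply: asbool_equiv_eq.
  have cuv : connected_component D (qp (gv i j)) (qp (gv i' j')).
    by apply: Wseg => //; exact: gv_strip.
  split=> h; first exact: connected_component_trans cuv.
  by apply: connected_component_trans h _; exact: connected_component_sym.
(* Translation by 1 carries row 0 to row [M] and the value of [u] to that of [shift u 1];
   independence of the row then brings the count back to row 0. *)
have crossS u : lft Psi u ->
    crossings lab M (E (shift u 1) : S') 0 = crossings lab M (E u : S') 0.
  move=> lu; rewrite -(crossings0 lab0 labM labC _ M).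
  rewrite /crossings; apply: eq_bigr => i _.
  have LS k : isL (lab k M) = isL (lab k 0%N).
    rewrite /lab -[in LHS](add0n M) gvS.
    have [b|b] := pselect (black (gv k 0)).
      by rewrite !lbB//; exact: blackS.
    by rewrite !lbW// ?qp_shift//; move=> /blackS'.
  have BS k : isB (E (shift u 1) : S') (lab k M) = isB (E u : S') (lab k 0%N).
    rewrite /lab -[in LHS](add0n M) gvS.
    have [b|b] := pselect (black (gv k 0)); last first.
      by rewrite !lbW//; move=> /blackS'.
    have bS := blackS _ b.
    rewrite !lbB//=; have [ln bn] := nptP _ b; have [lnS bnS] := nptP _ bS.
    (* The nearby points of a vertex and of its translate are chosen independently, but up to
       translation they differ by less than [4 * eta]. *)
    have -> : E (npt (shift (gv k 0) 1)) = E (shift (npt (gv k 0)) 1).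
      apply: dP => //; first exact/lft_shift.
      move/(ball_shift _ _ _ 1): bn => /ballR2P[a1 a2].
      move/ballR2P: bnS => [a3 a4]; apply/ballR2P.
      by move: a1 a2 a3 a4; rewrite !ltr_norml; lra.
    by apply/eqP/eqP => h; [apply: (iffRL (Eeqv ln lu))|apply: (iffLR (Eeqv ln lu))].
  by rewrite /cross !LS !BS.
have crossE u (n : int) : lft Psi u ->
    crossings lab M (E (shift u n) : S') 0 = crossings lab M (E u : S') 0.
  have nat_case (k : nat) w : lft Psi w ->
      crossings lab M (E (shift w k) : S') 0 = crossings lab M (E w : S') 0.
    move=> lw; elim: k => [|k IH]; first by rewrite shift0.
    by rewrite -IH -[RHS]crossS; [rewrite shiftD -PoszD addn1|exact/lft_shift].
  case: n => k lu; first exact: nat_case.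
  rewrite -[in RHS](shiftNK u k.+1) NegzE.
  by rewrite (nat_case k.+1)//; exact/lft_shift.
pose P (s : S') := exists2 u, lft Psi u & s = E u.
apply: (@labels_unique S' lab M lab0 labM labC P); last 2 first.
- by exists x.
- by exists y.
- move=> i s; rewrite /lab /lb; case: asboolP => // b [<-].
  by exists (npt (gv i 0)) => //; case: (nptP _ b).
move=> _ _ [u lu ->] [v lv ->]; have [n ->] := Eorbit lu lv.
by rewrite crossE.
Qed.

End Map.
End EquivariantlyConstant.

(** * Unrolled chains *)

Section LiftedChains.
Context {R : realType}.
Variable Psi : set (R * R).
Implicit Types x y z : R * R.

(* A circular chain of Psi unrolled to a bi-infinite chain of its lift; one
   turn around the annulus advances the index by [N]. *)
Record lifted_chain (e : R) (N : int) (L : int -> set (R * R)) : Prop := {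
  lc_pos : 0 < N;
  lc_open : forall m, exists2 U, open U & L m = lft Psi `&` U;
  lc_cov : forall x, lft Psi x -> exists m, L m x;
  lc_adj : forall m m' x, L m x -> L m' x -> `|m - m'| <= 1;
  lc_mesh : forall m x y, L m x -> L m y -> ball x e y;
  lc_shift : forall m x k, L m x -> L (m + N * k) (shift x k) }.

Lemma lt1_int (k : int) : `|k%:~R| < 1 :> R -> k = 0.
Proof. by rewrite -intr_norm (_ : 1 = 1%:~R)// ltr_int; lia. Qed.

Hypotheses (cPsi : compact Psi) (coPsi : connected Psi).
Hypotheses (intPsi : Psi `<=` @annulus_int R) (essPsi : essential Psi).
Hypotheses (Psi0 : Psi !=set0) (ccPsi : circularly_chainable Psi).

(** Over link [i] of a fine circular chain lie pieces around [shift (g i) k], one for each sheet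
    [k], with centres [g i] chosen so that consecutive ones are close. Passing from the last link to
    the first changes the sheet by a fixed [D]; once [D] is known to be 1 or -1, links and sheets
    can be numbered along a line. *)
Lemma lifted_chain_exists (e : R) : 0 < e -> exists N L, lifted_chain e N L.
Proof.
(* The bound [1 / 4] separates sheets: if pieces around centres less than [d] apart share a point,
   their sheet numbers differ by less than [2 * d < 1], hence agree. *)
move=> e0; pose d := Num.min e (1 / 4).
have d0 : 0 < d by rewrite lt_min e0 divr_gt0.
have de : d <= e by rewrite ge_min lexx.
have d4 : d <= 1 / 4 by rewrite ge_min lexx orbT.
have d2 : 0 < d / 2 by rewrite divr_gt0.
pose V : set (set (R * R)) := [set W | open W /\ exists c, forall y, strip y ->
  W (qp y) -> exists n, ball (shift c n) (d / 2) y].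
have [n [U [[oU covU refU] adjU]]] :
    exists n (U : nat -> set (R * R)), refining_cover Psi V n U /\
      forall i j, (i < n)%N -> (j < n)%N ->
        (U i `&` U j `&` Psi !=set0 <->
         [\/ nat_adj i j, (i == 0)%N && (j == n.-1) | (j == 0)%N && (i == n.-1)]).
  apply: ccPsi; first by move=> W [].
  move=> z Pz; have [x lx <-] := Psi_lft intPsi Pz.
  have [W [oW Wx WP]] := qp_open (lft_strip lx) d2.
  by exists W => //; split => //; exists x.
have n0 : (0 < n)%N.
  by case: Psi0 => z /covU[i /=]; case: (n).
have /choice[c cP] : forall i, exists c, (i < n)%N -> forall y, lft Psi y ->
    U i (qp y) -> exists k, ball (shift c k) (d / 2) y.
  move=> i; have [iln|_] := boolP (i < n)%N; last by exists 0.
  have [W [_ [c cP]] UW] := refU i iln; exists c => _ y ly Uy.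
  by apply: cP; [exact: lft_strip ly|apply: UW; split => //; case: ly].
have link i j : (i < n)%N -> (j < n)%N -> U i `&` U j `&` Psi !=set0 ->
    exists k, ball (c i) d (shift (c j) k).
  move=> iln jn [z [[Ui Uj] Pz]]; have [y ly yz] := Psi_lft intPsi Pz.
  rewrite -yz in Ui Uj.
  have [a ba] := cP _ iln _ ly Ui; have [b bb] := cP _ jn _ ly Uj.
  exists (b - a); apply/(ball_shift _ _ _ a); rewrite shiftD subrK.
  by rewrite [d]splitr; exact: ball_triangle ba (ball_sym bb).
have /choice[s sP] : forall i, exists k, (i.+1 < n)%N ->
    ball (c i) d (shift (c i.+1) k).
  move=> i; have [iln|_] := boolP (i.+1 < n)%N; last by exists 0.
  have [k kP] : exists k, ball (c i) d (shift (c i.+1) k).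
    by apply: link => //; [exact: ltnW|apply/adjU => //; [exact: ltnW|constructor 1; rewrite /nat_adj; lia]].
  by exists k.
(* The accumulated corrections put consecutive centres within [d] of each other. *)
pose off i : int := \sum_(0 <= j < i) s j.
pose g i := shift (c i) (off i).
have gP i y : (i < n)%N -> lft Psi y -> U i (qp y) ->
    exists k, ball (shift (g i) k) (d / 2) y.
  move=> iln ly Uy; have [k bk] := cP _ iln _ ly Uy; exists (k - off i).
  by rewrite /g shiftD addrC subrK.
have gS i : (i.+1 < n)%N -> ball (g i) d (g i.+1).
  move=> iln; rewrite /g /off big_nat_recr //= addrC -shiftD.
  exact/ball_shift/sP.
have [D DP] : exists D, ball (g n.-1) d (shift (g 0%N) D).
  have [k bk] : exists k, ball (c n.-1) d (shift (c 0%N) k).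
    apply: link; [lia|lia|]; apply/adjU; [lia|lia|].
    by constructor 3; rewrite !eqxx.
  exists (k + off n.-1); rewrite -shiftD.
  have -> : g 0%N = c 0%N by rewrite /g /off big_geq // shift0.
  exact/ball_shift.
(* The part of the lift over link [i] that lies in sheet [k]. *)
pose K i (k : int) x := [/\ (i < n)%N, U i (qp x), lft Psi x &
  ball (shift (g i) k) (d / 2) x].
have Kcov x : lft Psi x -> exists i k, K i k x.
  move=> lx; have [i /= iln Ui] := covU _ lx.2.
  by have [k bk] := gP i x iln lx Ui; exists i, k.
have near_eq (a b : R * R) (k k' : int) x : ball (shift a k) (d / 2) x ->
    ball (shift b k') (d / 2) x -> ball a d b -> k = k'.
  move=> /ballR2P[_ h1] /ballR2P[_ h2] /ballR2P[_ h3].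
  apply/eqP; rewrite -subr_eq0; apply/eqP/lt1_int.
  by move: h1 h2 h3; rewrite /= intrB !ltr_norml; lra.
have Kadj i j k k' x : K i k x -> K j k' x -> nat_adj i j -> k = k'.
  move=> [iln _ _ bi] [jn _ _ bj] /andP[h1 h2]; apply: near_eq bi bj _.
  have [e1|[e1|e1]] : i = j \/ j = i.+1 \/ i = j.+1 by lia.
  - by rewrite e1; exact: ballxx.
  - by rewrite e1; apply: gS; lia.
  - by rewrite e1; apply/ball_sym/gS; lia.
have Kend k k' x : K n.-1 k x -> K 0%N k' x -> k' = k + D.
  move=> [_ _ _ b1] [_ _ _ b0].
  have : k = k' - D.
    apply: near_eq b1 _ DP; by rewrite shiftD addrC subrK.
  lia.
have Kcase i j k k' x : K i k x -> K j k' x ->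
    [\/ nat_adj i j /\ k' = k, [/\ i = n.-1, j = 0%N & k' = k + D] |
      [/\ j = n.-1, i = 0%N & k = k' + D]].
  move=> Ki Kj; case: (Ki) (Kj) => [iln Ui lx _] [jn Uj _ _].
  have : U i `&` U j `&` Psi !=set0 by exists (qp x); split => //; case: lx.
  move=> /(adjU _ _ iln jn)[a|/andP[/eqP a /eqP b]|/andP[/eqP a /eqP b]].
  - by constructor 1; split => //; apply/esym; exact: Kadj Ki Kj a.
  - by subst; constructor 3; split => //; exact: Kend Kj Ki.
  - by subst; constructor 2; split => //; exact: Kend Ki Kj.
have Kmod i j k k' x : K i k x -> K j k' x -> (k = k' %[mod D])%Z.
  by move=> Ki Kj; have [[_ ->]|[_ _ ->]|[_ _ ->]] := Kcase _ _ _ _ _ Ki Kj;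
    rewrite ?modzDr.
have Kopen i k x : K i k x -> \forall y \near x, lft Psi y -> K i k y.
  move=> [iln Ui lx b].
  have n1 : \forall y \near x, U i (qp y).
    by apply: continuous_qp; exact: open_nbhs_nbhs.
  have n2 : \forall y \near x, ball (shift (g i) k) (d / 2) y.
    by apply: open_nbhs_nbhs; split => //; exact: ball_open.
  by near=> y => ly; split => //; [near: y|near: y].
have Kshift i k x m : K i k x -> K i (k + m) (shift x m).
  move=> [iln Ui lx b]; split => //; rewrite ?qp_shift//.
    exact/lft_shift.
  by rewrite -shiftD; exact/ball_shift.
(* The sheet number modulo [D] is locally constant, so the chain winds once. *)
have D1 : D * D = 1.
  pose E x : int := ((xget (0%N, 0%Z) [set p : nat * int | K p.1 p.2 x]).2 %% D)%Z.
  have EE i k x : K i k x -> E x = (k %% D)%Z.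
    move=> Ki; pose Q := [set p : nat * int | K p.1 p.2 x].
    have Kp : Q (xget (0%N, 0%Z) Q) by apply: xgetPex; exists (i, k).
    exact: Kmod Kp Ki.
  case: Psi0 => z /(Psi_lft intPsi)[x lx _].
  have := @equivariantly_constant R Psi cPsi coPsi intPsi essPsi _ E.
  move=> /(_ _ _ x (shift x 1) lx (iffRL (lft_shift _ _ _) lx)) EC.
  have {EC}: E x = E (shift x 1).
    apply: EC.
      move=> u lu; have [i [k Ki]] := Kcov u lu; rewrite (EE _ _ _ Ki).
      by apply: filterS (Kopen _ _ _ Ki) => v h /h; exact: EE.
    move=> u v lu lv; have [i [k Ki]] := Kcov u lu; have [j [m Kj]] := Kcov v lv.
    rewrite (EE _ _ _ Ki) (EE _ _ _ Kj) (EE _ _ _ (Kshift _ _ _ 1 Ki)).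
    rewrite (EE _ _ _ (Kshift _ _ _ 1 Kj)).
    by split=> /eqP h; apply/eqP; move: h; rewrite eqz_modDr.
  have [i [k Ki]] := Kcov x lx.
  rewrite (EE _ _ _ Ki) (EE _ _ _ (Kshift _ _ _ 1 Ki)) => /eqP.
  rewrite -{1}(addr0 k) eqz_modDl mod0z eq_sym => /eqP/dvdz_mod0P.
  by rewrite dvdzE dvdn1 => /eqP; lia.
(* From link [n - 1] in sheet [k] one passes to link 0 in sheet [k + D]; the index then changes by
   [n * D - D * (n - 1) = D], again one step. *)
exists n%:Z, (fun m => [set x | exists (i : nat) (k : int), K i k x /\ m = D * i%:Z + n%:Z * k]).
split.
- by rewrite ltz_nat.
- move=> m; exists (\bigcup_(p in [set p : nat * int | (p.1 < n)%N /\ m = D * p.1%:Z + n%:Z * p.2])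
    ([set x | U p.1 (qp x)] `&` ball (shift (g p.1) p.2) (d / 2))).
    apply: bigcup_open => p _; apply: openI; last exact: ball_open.
    by apply: (@open_comp _ _ qp (U p.1)) => // x _; exact: continuous_qp.
  apply/seteqP; split=> x /=.
    by move=> [i [k [[iln Ui lx b] mE]]]; split => //; exists (i, k).
  by move=> [lx [[i k] /= [iln mE] [Ui b]]]; exists i, k.
- by move=> x /Kcov[i [k Ki]]; exists (D * i%:Z + n%:Z * k), i, k.
- move=> _ _ x [i [k [Ki ->]]] [j [k' [Kj ->]]].
  have DD : D = 1 \/ D = -1 by nia.
  case: (Kcase _ _ _ _ _ Ki Kj).
  + by move=> [/andP[a b] ->]; case: DD => ->; lia.
  + by move=> [-> -> ->]; case: DD => ->; nia.
  + by move=> [-> -> ->]; case: DD => ->; nia.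
- move=> _ x y [i [k [Ki ->]]] [j [k' [Kj mE]]].
  case: (Ki) (Kj) => [iln _ _ bi] [jn _ _ bj].
  (* Equal indices give [n * (k - k') = D * (j - i)], and [i] and [j] are both less than [n]. *)
  have [ij kk] : i = j /\ k = k'.
    have DD : D = 1 \/ D = -1 by nia.
    suff : k = k' by move=> kk; split => //; case: DD mE => ->; rewrite kk; lia.
    have : (n%:Z * (k - k') = D * (j%:Z - i%:Z)) by lia.
    by case: DD => ->; nia.
  subst j k'; apply: (le_ball de); rewrite [d]splitr.
  exact: ball_triangle (ball_sym bi) bj.
- move=> _ x m [i [k [Ki ->]]]; exists i, (k + m); split; first exact: Kshift.
  by rewrite mulrDr addrA.
Unshelve. all: by end_near. Qed.

End LiftedChains.

(** * Continua in the lift *)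

Section LiftedContinua.
Context {R : realType}.
Variable Psi : set (R * R).
Hypotheses (intPsi : Psi `<=` @annulus_int R) (essPsi : essential Psi).
Hypotheses (contPsi : continuum R Psi) (ccPsi : circularly_chainable Psi).
Hypothesis hiPsi : hereditarily_indecomposable R Psi.
Implicit Types (x y z : R * R) (A B T : set (R * R)).

Let cPsi : compact Psi. Proof. by case: contPsi. Qed.
Let coPsi : connected Psi. Proof. by case: contPsi. Qed.
Let Psi0 : Psi !=set0. Proof. by case: contPsi. Qed.
Let clPsi : closed Psi.
Proof. by apply: compact_closed => //; exact: hausdorffR2. Qed.

Let chain (e : R) (e0 : 0 < e) :=
  lifted_chain_exists cPsi coPsi intPsi essPsi Psi0 ccPsi e0.

(** * Cutting connected sets along an unrolled chain *)

Section Chain.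
Variables (e : R) (N : int) (L : int -> set (R * R)).
Hypothesis LC : lifted_chain Psi e N L.

Lemma lc_lft m : L m `<=` lft Psi.
Proof. by move=> x; have [U _ ->] := lc_open LC m; case. Qed.

Lemma lc_union_open (P : int -> Prop) : exists2 U, open U &
  [set x | exists2 m, P m & L m x] = lft Psi `&` U.
Proof.
have /choice[U UP] : forall m, exists U, open U /\ L m = lft Psi `&` U.
  by move=> m; have [U oU UE] := lc_open LC m; exists U.
exists (\bigcup_(m in P) U m); first by apply: bigcup_open => m _; case: (UP m).
apply/seteqP; split=> x.
  move=> [m Pm Lm]; split; first exact: lc_lft Lm.
  by exists m => //; move: Lm; case: (UP m) => _ ->; case.
by move=> [lx [m Pm Um]]; exists m => //; case: (UP m) => _ ->.
Qed.

Lemma chain_split A (P Q : int -> Prop) : connected A -> A `<=` lft Psi ->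
  (forall m x, A x -> L m x -> P m \/ Q m) ->
  (forall m m' x, A x -> L m x -> L m' x -> P m -> Q m' -> False) ->
  (forall x m, A x -> L m x -> P m) \/ (forall x m, A x -> L m x -> Q m).
Proof.
move=> coA Al PQ nPQ.
have [UP oUP UPE] := lc_union_open P; have [UQ oUQ UQE] := lc_union_open Q.
have inP x : A x -> UP x -> exists2 m, P m & L m x.
  move=> Ax Ux; have : (lft Psi `&` UP) x by split => //; exact: Al.
  by rewrite -UPE.
have inQ x : A x -> UQ x -> exists2 m, Q m & L m x.
  move=> Ax Ux; have : (lft Psi `&` UQ) x by split => //; exact: Al.
  by rewrite -UQE.
have [ | |s|s] := @connected_open_split _ A UP UQ coA oUP oUQ.
- move=> x Ax; have [m Lm] := lc_cov LC (Al _ Ax).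
  have [Pm|Qm] := PQ _ _ Ax Lm; [left|right].
    have : [set x | exists2 m, P m & L m x] x by exists m.
    by rewrite UPE => -[].
  have : [set x | exists2 m, Q m & L m x] x by exists m.
  by rewrite UQE => -[].
- rewrite -subset0 => x [[Ax UPx] UQx].
  have [m Pm Lm] := inP _ Ax UPx; have [m' Qm Lm'] := inQ _ Ax UQx.
  exact: nPQ Ax Lm Lm' Pm Qm.
- left=> x m Ax Lm; have [m' Pm' Lm'] := inP _ Ax (s _ Ax).
  by have [//|Qm] := PQ _ _ Ax Lm; case: (nPQ _ _ _ Ax Lm' Lm Pm' Qm).
- right=> x m Ax Lm; have [m' Qm' Lm'] := inQ _ Ax (s _ Ax).
  by have [Pm|//] := PQ _ _ Ax Lm; case: (nPQ _ _ _ Ax Lm Lm' Pm Qm').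
Qed.

(** Links that meet have indices at most 1 apart, so no link below [b] meets one above [b]; a
    connected set avoiding link [b] stays on one side. *)
Lemma chain_cut A b : connected A -> A `<=` lft Psi -> (forall x, A x -> ~ L b x) ->
  (forall x m, A x -> L m x -> m < b) \/ (forall x m, A x -> L m x -> b < m).
Proof.
move=> coA Al nb; apply: chain_split => //.
  move=> m x Ax Lm; have [mb|bm|mb] := ltgtP m b; [by left|by right|].
  by case: (nb _ Ax); rewrite -mb.
by move=> m m' x _ Lm Lm' mb bm; have := lc_adj LC Lm Lm'; lia.
Qed.

Lemma chain_bounded m1 m2 : exists k : nat,
  forall m x, m1 <= m <= m2 -> L m x -> `|x.2| <= k%:R.
Proof.
have [le|lt] := leP m1 m2; last by exists 0%N => m x; lia.
have [p ->] : exists p : nat, m2 = m1 + p by exists `|m2 - m1|%N; lia.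
elim: p => [|p [k kP]].
  have [[y Ly]|nL] := pselect (L m1 !=set0); last first.
    exists 0%N => m x mE Lm; case: nL; exists x.
    by have <- : m = m1 by lia.
  exists (Num.bound (`|y.2| + e)) => m x mE Lm.
  have /(lc_mesh LC Ly)/ballR2P[_ h] : L m1 x by have <- : m = m1 by lia.
  apply: le_trans (ltW (archi_boundP _)).
    by have := ler_normB y.2 (y.2 - x.2); rewrite opprB addrC subrK; lra.
  by have := normr_ge0 (y.2 - x.2); have := normr_ge0 y.2; lra.
have [[y Ly]|nL] := pselect (L (m1 + p.+1) !=set0); last first.
  exists k => m x mE Lm; apply: (kP m) => //.
  have : m <> m1 + p.+1 by move=> h; apply: nL; exists x; rewrite -h.
  lia.
exists (maxn k (Num.bound (`|y.2| + e))) => m x mE Lm.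
have [mp|mp] := leP m (m1 + p).
  by apply: le_trans (kP m x _ Lm) _; [lia|rewrite ler_nat leq_maxl].
have /(lc_mesh LC Ly)/ballR2P[_ h] : L (m1 + p.+1) x.
  by have <- : m = m1 + p.+1 by lia.
apply: le_trans (_ : (Num.bound (`|y.2| + e))%:R <= _); last first.
  by rewrite ler_nat leq_maxr.
apply: le_trans (ltW (archi_boundP _)).
  by have := ler_normB y.2 (y.2 - x.2); rewrite opprB addrC subrK; lra.
by have := normr_ge0 (y.2 - x.2); have := normr_ge0 y.2; lra.
Qed.

End Chain.

(** With mesh small enough, a link through a lift of [z] lies over [W], and so do its translates,
    whose indices are the progression [a + N * k]. Sets that avoid [W] can be cut at all of
    these. *)
Lemma chain_avoiding (W : set (R * R)) z : Psi z -> open W -> W z ->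
  exists e N L, lifted_chain Psi e N L /\
  exists a, forall k x, L (a + N * k) x -> W (qp x).
Proof.
move=> Pz oW Wz; have [y ly yz] := Psi_lft intPsi Pz.
have : nbhs y [set x | W (qp x)].
  by apply: continuous_qp; rewrite yz; exact: open_nbhs_nbhs.
rewrite -nbhs_ballE => -[e /= e0 eW].
have [N [L LC]] := chain e0; exists e, N, L; split => //.
have [a La] := lc_cov LC ly; exists a => k x Lx.
have := lc_shift LC (- k) Lx.
rewrite mulrN addrK => /(lc_mesh LC La)/eW /=.
by rewrite qp_shift.
Qed.

(** Two points of [A] differing by a nonzero translation would have link indices at least [N] apart,
    hence be separated by one of the links lying over [W], which [A] avoids. *)
Lemma qp_inj_connected A (W : set (R * R)) z : connected A -> A `<=` lft Psi ->
  Psi z -> open W -> W z -> (forall x, A x -> ~ W (qp x)) ->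
  forall x n, A x -> A (shift x n) -> n = 0.
Proof.
move=> coA Al Pz oW Wz AW.
have [e [N [L [LC [a aW]]]]] := chain_avoiding Pz oW Wz.
have N0 := lc_pos LC.
have key x n : A x -> A (shift x n) -> 0 < n -> False.
  move=> Ax Axn n0; have [m Lm] := lc_cov LC (Al _ Ax).
  pose q := ((a - m) %/ N)%Z; pose r := ((a - m) %% N)%Z.
  have aE : a - m = q * N + r by exact: divz_eq.
  have r0 : 0 <= r by apply: modz_ge0; lia.
  have rN : r < N by apply: ltz_pmod.
  (* This is [m + r], the first index from [m] on that is congruent to [a] modulo [N]. *)
  pose b := a + N * - q.
  have Ab u : A u -> ~ L b u by move=> Au /aW; exact: AW.
  have bm : m <= b < m + N by rewrite /b; lia.
  have mb : m <> b by move=> mb; apply: (Ab _ Ax); rewrite -mb.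
  have Lmn := lc_shift LC n Lm.
  have [h|h] := chain_cut LC coA Al Ab.
    by have := h _ _ Axn Lmn; nia.
  by have := h _ _ Ax Lm; lia.
move=> x n Ax Axn; have [n0|n0|//] := ltgtP n 0.
  by case: (key (shift x n) (- n)); rewrite ?shiftK//; lia.
by case: (key x n).
Qed.

(** The preimage of [P] misses the links [b - N] and [b]. The part between them is compact, contains
    a translate of every point over [P], and is mapped injectively, so it inherits connectedness
    from [P]. *)
Lemma lift_continuum (P W : set (R * R)) z x : compact P -> connected P ->
  P `<=` Psi -> Psi z -> open W -> W z -> P `&` W = set0 -> lft Psi x -> P (qp x) ->
  exists B, [/\ compact B, connected B, B `<=` lft Psi, B x & qp @` B = P].
Proof.
move=> cP coP PPsi Pz oW Wz PW lx Px.
have [e [N [L [LC [a aW]]]]] := chain_avoiding Pz oW Wz.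
have N0 := lc_pos LC.
have nW y : P (qp y) -> ~ W (qp y).
  by move=> Py Wy; have : set0 (qp y) by rewrite -PW.
have [m Lm] := lc_cov LC lx.
pose q := ((a - m) %/ N)%Z; pose r := ((a - m) %% N)%Z.
have aE : a - m = q * N + r by exact: divz_eq.
have r0 : 0 <= r by apply: modz_ge0; lia.
have rN : r < N by apply: ltz_pmod.
pose b := a + N * - q.
have nb y : P (qp y) -> ~ L b y by move=> Py /aW; exact: nW.
have nb' y : P (qp y) -> ~ L (b - N) y.
  have -> : b - N = a + N * (- q - 1) by rewrite /b; lia.
  by move=> Py /aW; exact: nW.
pose ins m := b - N < m < b.
have mb : ins m.
  have : m <> b by move=> h; apply: (nb _ Px); rewrite -h.
  by rewrite /ins /b; lia.
have insP y m1 m2 : P (qp y) -> L m1 y -> L m2 y -> ins m1 -> ins m2.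
  move=> Py L1 L2; have := lc_adj LC L1 L2.
  have : m2 <> b by move=> h; apply: (nb _ Py); rewrite -h.
  have : m2 <> b - N by move=> h; apply: (nb' _ Py); rewrite -h.
  by rewrite /ins; lia.
have [U oU UE] := lc_union_open LC (fun m => ~ ins m).
(* The window is cut out by removing the open union of all outside links, which makes [B] closed;
   [BP] shows that nothing inside the window is lost. *)
pose B := (lft Psi `&` (qp @^-1` P)) `&` ~` U.
have BP y : B y <-> [/\ lft Psi y, P (qp y) & exists2 m, ins m & L m y].
  split.
    move=> [[ly Py] nU]; split => //; have [k Lk] := lc_cov LC ly.
    exists k => //; apply: contrapT => nk; apply: nU.
    have : [set x | exists2 m, ~ ins m & L m x] y by exists k.
    by rewrite UE => -[].
  move=> [ly Py [k ik Lk]]; split => // Uy.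
  have : (lft Psi `&` U) y by [].
  by rewrite -UE => -[j nj Lj]; apply: nj; exact: insP Lk Lj ik.
have clP : closed P by apply: compact_closed => //; exact: hausdorffR2.
have Bl : B `<=` lft Psi by move=> y [[]].
have cB : compact B.
  have [k kP] := chain_bounded LC (b - N) b.
  apply: (@bounded_compact_lft _ _ k%:R _ clPsi) => //.
    apply: closedI; last exact: open_closedC.
    apply: closedI; first exact: closed_lft.
    by apply: preimage_closed => // ? _; exact: continuous_qp.
  by move=> y /BP[_ _ [j ij Lj]]; apply: (kP j) => //; move: ij; rewrite /ins; lia.
have qB : qp @` B = P.
  apply/seteqP; split=> [_ [y /BP[]] _ Py _ <-//|p Pp].
  have [y ly yp] := Psi_lft intPsi (PPsi _ Pp).
  have [k Lk] := lc_cov LC ly.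
  pose q' := ((k - b) %/ N)%Z; pose r' := ((k - b) %% N)%Z.
  have kE : k - b = q' * N + r' by exact: divz_eq.
  have r0' : 0 <= r' by apply: modz_ge0; lia.
  have rN' : r' < N by apply: ltz_pmod.
  (* This translation brings the index [k] to [b - N + r'], which is at least [b - N] and below
     [b]. *)
  have Lk' := lc_shift LC (- q' - 1) Lk.
  exists (shift y (- q' - 1)); last by rewrite qp_shift.
  apply/BP; rewrite qp_shift yp; split => //; first exact/lft_shift.
  exists (k + N * (- q' - 1)) => //.
  have : k + N * (- q' - 1) <> b - N.
    by move=> h; rewrite h in Lk'; apply: nb' Lk'; rewrite qp_shift yp.
  by rewrite /ins; lia.
exists B; split => //; last by apply/BP; split => //; exists m.
apply: (@connected_inj_image _ _ qp B hausdorffR2 _ _ hausdorffR2 cB); last by rewrite qB.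
  by move=> y _; exact: continuous_qp.
(* A translation by [k] moves indices by [N * k]. Indices strictly inside the window differ by at
   most [N - 2], and adjacency adds at most 1, so [k] is 0. *)
move=> y1 y2 /set_mem/BP[l1 _ [m1 i1 L1]] /set_mem/BP[l2 P2 [m2 i2 L2]] e12.
have [k kE] := qp_inj (lft_strip l1) (lft_strip l2) e12.
have L3 := lc_shift LC k L1; rewrite -kE in L3.
have := lc_adj LC L2 L3; move: i1 i2; rewrite /ins => i1 i2 h.
suff k0 : k = 0 by rewrite kE k0 shift0.
have [k0|k0|//] := ltgtP k 0; nia.
Qed.

Lemma compact_qp B : compact B -> compact (qp @` B).
Proof.
move=> cB; apply: continuous_compact => //.
by apply: continuous_subspaceT; exact: continuous_qp.
Qed.

Lemma closed_qp B : compact B -> closed (qp @` B).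
Proof. by move=> cB; apply: compact_closed; [exact: hausdorffR2|exact: compact_qp]. Qed.

Lemma connected_qp B : connected B -> connected (qp @` B).
Proof.
move=> cB; apply: connected_continuous_connected => //.
by apply: continuous_subspaceT; exact: continuous_qp.
Qed.

Lemma qp_subcontinuum B : B !=set0 -> compact B -> connected B -> B `<=` lft Psi ->
  subcontinuum R Psi (qp @` B).
Proof.
move=> [x Bx] cB coB Bl; apply: subcontinuumI => //.
- by move=> _ [y /Bl[_ Py] <-].
- by exists (qp x); exists x.
- exact: compact_qp.
- exact: connected_qp.
Qed.

Lemma lift_subset A B z : compact A -> connected A -> A `<=` lft Psi ->
  compact B -> connected B -> B `<=` lft Psi -> A `&` B !=set0 ->
  Psi z -> ~ (qp @` A) z -> qp @` B `<=` qp @` A -> B `<=` A.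
Proof.
move=> cA coA Al cB coB Bl AB Pz nA BA b Bb.
have [a Aa qab] : (qp @` A) (qp b) by apply: BA; exists b.
have [n nE] := qp_inj (lft_strip (Bl _ Bb)) (lft_strip (Al _ Aa)) (esym qab).
suff n0 : n = 0 by rewrite -(shift0 b) -n0 -nE.
apply: (@qp_inj_connected (A `|` B) (~` (qp @` A)) z _ _ Pz _ nA _ b n).
- exact: connectedU.
- by move=> x [/Al|/Bl].
- exact/closed_openC/closed_qp.
- by move=> x [Ax|Bx]; apply; [exists x|apply: BA; exists x].
- by right.
- by left; rewrite -nE.
Qed.

Lemma sep_closure (F : set (R * R)) z : closed F -> ~ F z ->
  exists Q, [/\ open Q, Q z & closure Q `&` F = set0].
Proof.
move=> cF nF.
have : nbhs z (~` F) by apply: open_nbhs_nbhs; split => //; exact: closed_openC.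
rewrite -nbhs_ballE => -[e /= e0 eF].
have e2 : 0 < e / 2 by rewrite divr_gt0.
exists (ball z (e / 2)); split; [exact: ball_open|exact: ballxx|].
rewrite -subset0 => w [cw Fw].
have [u [zu wu]] := cw _ (nbhsx_ballx w _ e2).
apply: (eF w) => //; rewrite [e]splitr.
exact: ball_triangle zu (ball_sym wu).
Qed.

Let saturated T := forall B, compact B -> connected B -> B `<=` lft Psi ->
  (exists2 z, Psi z & ~ (qp @` B) z) -> B `&` T !=set0 -> B `<=` T.

Let full_saturated A : compact A -> connected A -> A `<=` lft Psi ->
  Psi `<=` qp @` A -> saturated A.
Proof.
move=> cA coA Al fA B cB coB Bl [z Pz nBz] [x [Bx Ax]].
have [Q [oO Oz OB]] := sep_closure (closed_qp cB) nBz.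
have nOB y : B y -> ~ closure Q (qp y).
  move=> By Oy; have : set0 (qp y) by rewrite -OB; split => //; exists y.
  by [].
have cq (G : set (R * R)) : closed G -> closed (qp @^-1` G).
  by move=> cG; apply: preimage_closed => // ? _; exact: continuous_qp.
have clA : closed A by apply: compact_closed => //; exact: hausdorffR2.
pose Y := A `&` qp @^-1` (~` Q).
have clY : closed Y by apply: closedI => //; apply: cq; exact: open_closedC.
have cY : compact Y.
  by apply: compact_closedI => //; apply: cq; exact: open_closedC.
have Yx : Y x by split => // Ox; apply: (nOB x) => //; exact: subset_closure.
have [ | |y Cy Fy] := @boundary_bumping R _ hausdorffR2 A Y (qp @^-1` closure Q) x coA cY
  (cq _ (@closed_closure _ _)) (@subIsetl _ _ _) _ Yx.
- move=> YA; have [a Aa az] := fA _ Pz.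
  have : Y a by rewrite YA.
  by move=> [_]; rewrite /= az.
- exists (~` (qp @^-1` closure Q)); first by apply: closed_openC; apply: cq; exact: closed_closure.
  apply/seteqP; split=> u; first by move=> [[Au _] nF].
  by move=> [Au nF]; split => //; split => // Ou; apply: nF; exact: subset_closure.
pose A1 := connected_component Y x.
have A1Y : A1 `<=` Y by exact: connected_component_sub.
have A1x : A1 x by exact: connected_component_refl.
have cA1 : compact A1.
  by apply: subclosed_compact cY A1Y; exact: component_closed.
have coA1 : connected A1 by exact: component_connected.
have A1l : A1 `<=` lft Psi by move=> u /A1Y[/Al].
have s1 := qp_subcontinuum (ex_intro _ x A1x) cA1 coA1 A1l.
have s2 := qp_subcontinuum (ex_intro _ x Bx) cB coB Bl.
have AB : qp @` A1 `&` qp @` B !=set0 by exists (qp x); split; exists x.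
have [sub|sub] := subcontinua_nested contPsi hiPsi s1 s2 AB.
  have [b Bb by_] : (qp @` B) (qp y) by apply: sub; exists y.
  by case: (nOB _ Bb); rewrite by_.
suff : B `<=` A1 by move=> h u /h/A1Y[].
apply: (lift_subset cA1 coA1 A1l cB coB Bl _ Pz _ sub); first by exists x.
by move=> [u /A1Y[_ nO] uz]; apply: nO; rewrite uz.
Qed.

(** If [T] misses the fibre of [z], take the component of [qp x] in [Psi] minus a neighbourhood of
    [z]. It reaches the closure of that neighbourhood, while its lift through [x] is contained in
    [T] by saturation, a contradiction. *)
Let saturated_full T : compact T -> T `<=` lft Psi -> T !=set0 -> saturated T ->
  Psi `<=` qp @` T.
Proof.
move=> cT Tl [x Tx] sT z Pz; apply: contrapT => nTz.
have [Q [oO Oz OT]] := sep_closure (closed_qp cT) nTz.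
have nOT y : T y -> ~ closure Q (qp y).
  move=> Ty Oy; have : set0 (qp y) by rewrite -OT; split => //; exists y.
  by [].
pose Y := Psi `&` ~` Q.
have cY : compact Y by apply: compact_closedI => //; exact: open_closedC.
have Yx : Y (qp x).
  split; first by case: (Tl _ Tx).
  by move=> Ox; apply: (nOT x) => //; exact: subset_closure.
have [ | |y Cy Fy] := @boundary_bumping R _ hausdorffR2 Psi Y (closure Q) (qp x) coPsi cY
  (@closed_closure _ _) (@subIsetl _ _ _) _ Yx.
- move=> YA; have : Y z by rewrite YA.
  by move=> [].
- exists (~` closure Q); first by apply: closed_openC; exact: closed_closure.
  apply/seteqP; split=> u; first by move=> [[Au _] nF].
  by move=> [Au nF]; split => //; split => // Ou; apply: nF; exact: subset_closure.
pose P := connected_component Y (qp x).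
have PY : P `<=` Y by exact: connected_component_sub.
have Px : P (qp x) by exact: connected_component_refl.
have cP : compact P.
  apply: subclosed_compact cY PY; apply: component_closed.
  by apply: closedI => //; exact: open_closedC.
have [ | | |B [cB coB Bl Bx qB]] := @lift_continuum P Q z x cP _ _ Pz oO Oz _ (Tl _ Tx) Px.
- exact: component_connected.
- by move=> u /PY[].
- by rewrite -subset0 => u [/PY[_ ?]].
have BT : B `<=` T.
  apply: sT => //; last by exists x.
  by exists z => //; rewrite qB => /PY[].
have [b Bb by_] : (qp @` B) y by rewrite qB.
by apply: (nOT b (BT _ Bb)); rewrite by_.
Qed.

Lemma lifted_not_full A : compact A -> connected A -> A `<=` lft Psi ->
  exists2 z, Psi z & ~ (qp @` A) z.
Proof.
move=> cA coA Al; apply: contrapT => nex.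
have fA : Psi `<=` qp @` A.
  by move=> z Pz; apply: contrapT => nA; apply: nex; exists z.
have sA := full_saturated cA coA Al fA.
have clA : closed A by apply: compact_closed => //; exact: hausdorffR2.
have [kA kP] := compact_bounded2 cA.
pose meets (n : nat) := `[< exists2 x, A x & A (shift x n) >].
have ex0 : exists n, meets n.
  case: Psi0 => z /fA[x Ax _]; exists 0%N; apply/asboolP; exists x => //.
  by rewrite shift0.
have bnd n : meets n -> (n <= kA + kA)%N.
  move=> /asboolP[x /kP h1 /kP h2]; rewrite -(ler_nat R) natrD.
  by move: h1 h2; rewrite /= -pmulrn !ler_norml => /andP[? ?] /andP[? ?]; lra.
have [n /asboolP[x Ax Axn] nmax] := ex_maxnP ex0 bnd.
(* [T] is the last nonempty overlap of [A] with a translate, so that its own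
   translates are disjoint and tile the lift of Psi. *)
pose T := A `&` (shift^~ n) @^-1` A.
have cT : compact T.
  apply: compact_closedI => //; apply: preimage_closed => // ? _.
  exact: continuous_shift.
have clT : closed T by apply: compact_closed => //; exact: hausdorffR2.
have Tl : T `<=` lft Psi by move=> u [/Al].
have sT : saturated T.
  (* Both [A] and its translate by [- n] are saturated, so their intersection is. *)
  move=> B cB coB Bl [z Pz nz] [u [Bu [Au Aun]]] v Bv; split.
    by apply: (sA B) => //; [exists z|exists u].
  have csh : {within B, continuous (shift^~ n)}.
    by apply: continuous_subspaceT; exact: continuous_shift.
  apply: (sA ((shift^~ n) @` B)) => //; last by exists v.
  - exact: continuous_compact.
  - exact: connected_continuous_connected.
  - by move=> _ [w /Bl lw <-]; exact/lft_shift.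
  - by exists z => // -[_ [w Bw <-]]; rewrite qp_shift => wz; apply: nz; exists w.
  - by exists (shift u n); split => //; exists u.
have fT := saturated_full cT Tl (ex_intro _ x (conj Ax Axn)) sT.
(* If [u] and [u + k] lie in [T], then [u] and [u + k + n] lie in [A], and maximality of [n] forces
   [k = 0]. *)
have disj_pos u (k : nat) : T u -> T (shift u k) -> k = 0%N.
  move=> [Au _] [_ /=]; rewrite shiftD -PoszD => Auk.
  have : meets (k + n)%N by apply/asboolP; exists u.
  by move/nmax; lia.
have uniq u (k k' : int) : T (shift u k) -> T (shift u k') -> k = k'.
  wlog le : k k' / k <= k'.
    move=> H; have [|/ltW] := leP k k' => h T1 T2; first exact: H.
    by apply/esym; exact: H.
  move=> T1 T2; have kE : k' - k = `|k' - k|%N by lia.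
  have : T (shift (shift u k) `|k' - k|%N) by rewrite shiftD -kE addrC subrK.
  by move=> /(disj_pos _ _ T1); lia.
have exk u : lft Psi u -> exists k, T (shift u k).
  move=> lu; have [t Tt tu] := fT _ lu.2.
  have [k kE] := qp_inj (lft_strip lu) (lft_strip (Tl _ Tt)) (esym tu).
  by exists k; rewrite -kE.
(* The unique translation taking [u] into [T]; the default 0 is never reached on the lift. It drops
   by 1 under [u |-> u + 1], so it cannot be constant. *)
pose E u : int := xget 0 [set k | T (shift u k)].
have EE u k : T (shift u k) -> E u = k.
  move=> Tk; pose Q := [set k | T (shift u k)].
  have TQ : Q (xget 0 Q) by apply: xgetPex; exists k.
  exact: uniq TQ Tk.
have lx := Al _ Ax; have [k Tk] := exk _ lx.
have : E x = E (shift x 1).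
  apply: (@equivariantly_constant R Psi cPsi coPsi intPsi essPsi _ E _ _ _ _ lx);
    last exact/lft_shift.
  - move=> u lu; have [j Tj] := exk u lu; rewrite (EE _ _ Tj).
    (* Since [T] is bounded, [E v] lies between [- q] and [q] for all [v] near [u]. Only finitely
       many closed translates of [T] compete, and those not containing [u] are avoided nearby. *)
    pose q := (kA + Num.bound (`|u.2| + 1))%N.
    have fin : \forall v \near u, forall i : 'I_(q + q).+1,
        i%:Z - q%:Z <> j -> ~ T (shift v (i%:Z - q%:Z)).
      apply: (@filter_forall _ _ (fun (i : 'I_(q + q).+1) v =>
        i%:Z - q%:Z <> j -> ~ T (shift v (i%:Z - q%:Z))) (nbhs u) _) => i; have [ij|ij] := pselect (i%:Z - q%:Z = j).
        by apply: nearW => v /(_ ij).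
      have : \forall v \near u, (~` T) (shift v (i%:Z - q%:Z)).
        apply: continuous_shift; apply: open_nbhs_nbhs; split.
          exact: closed_openC.
        by move=> Ti; apply: ij; exact: uniq Ti Tj.
      by apply: filterS => v h _.
    have bu : \forall v \near u, ball u 1 v by exact: nbhsx_ballx.
    apply: filterS2 fin bu => v fin /ballR2P[_ bv] lv.
    have [j' Tj'] := exk v lv; rewrite (EE _ _ Tj').
    apply: contrapT => jj.
    have h1 := kP _ Tj'.1; rewrite /= in h1.
    have h2 : `|u.2| + 1 < (Num.bound (`|u.2| + 1))%:R.
      by apply: archi_boundP; rewrite addr_ge0.
    have h3 : `|j'%:~R| <= q%:R :> R.
      have h4 : `|j'%:~R| <= `|v.2 + j'%:~R| + `|v.2| :> R.
        by rewrite -[X in `|X| <= _](addKr v.2) addrC; exact: ler_normB.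
      have h5 : `|v.2| <= `|u.2| + `|u.2 - v.2|.
        by have := ler_normB u.2 (u.2 - v.2); rewrite opprB addrC subrK.
      by rewrite /q natrD; lra.
    have h4 : `|j'| <= q.
      by move: h3; rewrite -intr_norm pmulrn ler_int.
    have iq : (`|(j' + q%:Z)%R|%N < (q + q).+1)%N by lia.
    have iE : (Ordinal iq)%:Z - q%:Z = j' by rewrite /=; lia.
    by apply: (fin (Ordinal iq)); rewrite iE.
  - move=> u v lu lv; have [j Tj] := exk u lu; have [i Ti] := exk v lv.
    have Tj' : T (shift (shift u 1) (j - 1)) by rewrite shiftD addrC subrK.
    have Ti' : T (shift (shift v 1) (i - 1)) by rewrite shiftD addrC subrK.
    by rewrite (EE _ _ Tj) (EE _ _ Ti) (EE _ _ Tj') (EE _ _ Ti'); split; lia.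
have Tk' : T (shift (shift x 1) (k - 1)) by rewrite shiftD addrC subrK.
by rewrite (EE _ _ Tk) (EE _ _ Tk'); lia.
Qed.

(** The projections are nested by hereditary indecomposability. Neither is all of [Psi], so the
    inclusion lifts. *)
Lemma lifted_nested A B : compact A -> connected A -> A `<=` lft Psi ->
  compact B -> connected B -> B `<=` lft Psi -> A `&` B !=set0 ->
  A `<=` B \/ B `<=` A.
Proof.
move=> cA coA Al cB coB Bl AB; case: (AB) => x [Ax Bx].
have s1 := qp_subcontinuum (ex_intro _ x Ax) cA coA Al.
have s2 := qp_subcontinuum (ex_intro _ x Bx) cB coB Bl.
have meets : qp @` A `&` qp @` B !=set0 by exists (qp x); split; exists x.
have [sub|sub] := subcontinua_nested contPsi hiPsi s1 s2 meets.
  have [z Pz nz] := lifted_not_full cB coB Bl.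
  by left; apply: lift_subset Pz nz sub => //; rewrite setIC.
have [z Pz nz] := lifted_not_full cA coA Al.
by right; apply: lift_subset Pz nz sub.
Qed.


End LiftedContinua.

(** * The quotient space *)

Section CappedDistance.
Context {R : realType} {C : pseudoMetricType R}.
Implicit Types a b c : C.

Definition capset a b : set R := [set e | 0 < e /\ (1 <= e \/ ball a e b)].
Definition capdist a b : R := inf (capset a b).

Let cap_lb a b : has_lbound (capset a b).
Proof. by exists 0 => e [/ltW]. Qed.

Let cap_ne a b : capset a b !=set0.
Proof. by exists 1; split => //; left. Qed.

Lemma capdist_ge0 a b : 0 <= capdist a b.
Proof. by apply: lb_le_inf => // e [/ltW]. Qed.

Lemma capdist_le1 a b : capdist a b <= 1.
Proof. by apply: ge_inf => //; split => //; left. Qed.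

Lemma capdist_ball a b e : 0 < e -> ball a e b -> capdist a b <= e.
Proof. by move=> e0 bab; apply: ge_inf => //; split => //; right. Qed.

Lemma capdistC a b : capdist a b = capdist b a.
Proof.
congr inf; apply/seteqP; split=> e [e0 [e1|be]]; split => //; [by left| |by left|];
  by right; exact: ball_sym.
Qed.

Lemma capdist_tri a b c : capdist a c <= capdist a b + capdist b c.
Proof.
rewrite -lerBlDr; apply: lb_le_inf => // e1 [e10 b1].
rewrite lerBlDr -lerBlDl; apply: lb_le_inf => // e2 [e20 b2].
rewrite lerBlDl; apply: ge_inf => //; split; first exact: addr_gt0.
case: b1 => [b1|b1]; first by left; lra.
case: b2 => [b2|b2]; first by left; lra.
by right; exact: ball_triangle b1 b2.
Qed.

Lemma capdistxx a : capdist a a = 0.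
Proof.
apply/eqP; rewrite eq_le capdist_ge0 andbT leNgt; apply/negP => d0.
have d2 : 0 < capdist a a / 2 by rewrite divr_gt0.
by have := capdist_ball d2 (ballxx a d2); lra.
Qed.

Lemma capdist0_eq a b : hausdorff_space C -> capdist a b = 0 -> a = b.
Proof.
move=> hC d0; apply: hC => A B; rewrite -!nbhs_ballE => -[e /= e0 eA] Bb.
exists b; split; last by case: Bb => d /= d00; apply; exact: ballxx.
apply: eA; pose e' := Num.min e 1.
have e0' : 0 < e' by rewrite lt_min e0 ltr01.
have [r [r0 rb] re] : exists2 r, capset a b r & r < e'.
  by apply: inf_lt => //; rewrite -/(capdist a b) d0.
have [|] := rb; first by move: re; rewrite lt_min => /andP[_]; lra.
by apply: le_ball; move: re; rewrite lt_min => /andP[/ltW].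
Qed.

Lemma capdist_dist a b c : `|capdist a b - capdist a c| <= capdist b c.
Proof.
have h1 := capdist_tri a b c; have h2 := capdist_tri a c b.
by rewrite (capdistC c b) in h2; rewrite ler_norml; apply/andP; split; lra.
Qed.

End CappedDistance.

(** * Strip and leaf coordinates on the quotient *)

Section Suspension.
Context {R : realType} {C : pseudoMetricType R} (h : homeo C).
Local Open Scope quotient_scope.
Implicit Types (x y : R * R) (c : C) (n : int).

Lemma hpow_continuous n : continuous (hpow h n).
Proof.
case: n => k /=.
  elim: k => [|k IH] c /=; first exact: cvg_id.
  by apply: continuous_comp; [exact: IH|exact: hfun_cont].
elim: k => [|k IH] c /=; first exact: hinv_cont.
by apply: (@continuous_comp _ _ _ (iter k.+1 (hinv h)) (hinv h)); [exact: IH|exact: hinv_cont].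
Qed.

Lemma hpowK n c : hpow h n (hpow h (- n) c) = c.
Proof. by rewrite -hpowD subrr. Qed.

Lemma hpowNK n c : hpow h (- n) (hpow h n c) = c.
Proof. by rewrite -hpowD addNr. Qed.

Let Q : topologicalType := PSQ h.
Let proj : PST C -> Q := \pi_Q.

Let projP (p p' : PST C) : proj p = proj p' <-> ps_rel_prop h p p'.
Proof.
split; first by move=> /(@eqmodP _ (ps_equiv h))/asboolP.
by move=> H; apply/(@eqmodP _ (ps_equiv h))/asboolP.
Qed.

Let act n (p : PST C) : PST C := ((p.1.1, p.1.2 + n%:~R), hpow h (- n) p.2).

Let act_continuous n : continuous (act n).
Proof.
move=> p; apply: (@cvg_pair _ _ _ (nbhs p) (nbhs (act n p).1) (nbhs (act n p).2) _ _ _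
  (fun p : PST C => (p.1.1, p.1.2 + n%:~R)) (fun p : PST C => hpow h (- n) p.2)).
  apply: (@cvg_pair _ _ _ (nbhs p) (nbhs p.1.1) (nbhs (p.1.2 + n%:~R)) _ _ _
    (fun p : PST C => p.1.1) (fun p : PST C => p.1.2 + n%:~R)).
    by apply: (@cvg_comp _ _ _ fst fst); exact: cvg_fst.
  apply: cvgD; last exact: cvg_cst.
  by apply: (@cvg_comp _ _ _ fst snd); [exact: cvg_fst|exact: cvg_snd].
by apply: (@continuous_comp _ _ _ snd (hpow h (- n))); [exact: cvg_snd|exact: hpow_continuous].
Qed.

(** The quotient map is open: near each point of the saturation of an open [U], one of the
    continuous maps [act n] leads back into [U]. *)
Let nbhs_proj (p : PST C) (A : set Q) : nbhs (proj p) A <-> nbhs p (proj @^-1` A).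
Proof.
split; first exact: pi_continuous.
move=> nP; have [U [oU Up] UA] : exists2 U, open_nbhs p U & U `<=` proj @^-1` A.
  by move: nP; rewrite nbhsE.
suff oV : open (proj @` U).
  have : nbhs (proj p) (proj @` U) by apply: open_nbhs_nbhs; split => //; exists p.
  by apply: filterS => _ [u Uu <-]; exact: UA.
have -> : open (proj @` U) = open (proj @^-1` (proj @` U)) by [].
rewrite openE => p' [u Uu /projP[e1 [n [e2 e3]]]].
have uE : u = act (- n) p'.
  case: u p' {Uu} e1 e2 e3 => [[s r] c] [[s' r'] c'] /= -> -> ->.
  by rewrite /act /= mulrNz addrK opprK hpowK.
rewrite uE in Uu.
have nU : \forall p2 \near p', U (act (- n) p2).
  by apply: act_continuous; exact: open_nbhs_nbhs.
rewrite /interior; apply: filterS nU => p2 /= Up2; exists (act (- n) p2) => //.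
by apply/projP; split => //; exists n; rewrite /act /= mulrNz subrK opprK hpowNK.
Qed.

Lemma clampI_proof (s : R) : unit_interval (Num.max 0 (Num.min s 1)).
Proof.
by rewrite /unit_interval /= in_itv /= le_max lexx ge_max ler01 ge_min lexx orbT.
Qed.

Definition clampI (s : R) : set_type (@unit_interval R) :=
  exist (fun t => t \in @unit_interval R) _ (mem_set (clampI_proof s)).

(* The first coordinate is clamped to [0, 1] to make the map total. *)
Definition iota x c : PSQ h := proj ((clampI x.1, x.2), c).

Lemma clampI_id x : strip x -> \val (clampI x.1) = x.1.
Proof.
move=> /andP[x0 x1]; rewrite /= min_l// max_r//.
Qed.

Lemma clampI_val (s : set_type (@unit_interval R)) : clampI (\val s) = s.
Proof.
apply: val_inj => /=; have := set_valP s.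
rewrite /unit_interval /= in_itv /= => /andP[s0 s1].
by rewrite min_l// max_r.
Qed.

Lemma clampI_continuous : continuous clampI.
Proof.
apply: continuous_comp_initial => s /=.
have c1 : (fun t : R^o => Num.min t 1) @ s --> Num.min s 1.
  by apply: (@continuous_min _ _ (fun t : R^o => t) (cst 1)); [exact: cvg_id|exact: cvg_cst].
by apply: (@continuous_max _ _ (cst 0) (fun t : R^o => Num.min t 1)); [exact: cvg_cst|exact: c1].
Qed.

Lemma iota_continuous : continuous (fun p : (R * R) * C => iota p.1 p.2).
Proof.
move=> p.
apply: (@continuous_comp _ _ _ (fun p : (R * R) * C => ((clampI p.1.1, p.1.2), p.2) : PST C) proj);
  last exact: pi_continuous.
apply: (@cvg_pair _ _ _ (nbhs p) (nbhs (clampI p.1.1, p.1.2)) (nbhs p.2) _ _ _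
  (fun p : (R * R) * C => (clampI p.1.1, p.1.2)) snd); last exact: cvg_snd.
apply: (@cvg_pair _ _ _ (nbhs p) (nbhs (clampI p.1.1)) (nbhs p.1.2) _ _ _
  (fun p : (R * R) * C => clampI p.1.1) (fun p : (R * R) * C => p.1.2)).
  apply: (@continuous_comp _ _ _ (fun p : (R * R) * C => p.1.1) clampI).
    by apply: (@cvg_comp _ _ _ fst fst); exact: cvg_fst.
  exact: clampI_continuous.
by apply: (@cvg_comp _ _ _ fst snd); [exact: cvg_fst|exact: cvg_snd].
Qed.

(** Neighbourhoods in the quotient can be tested in strip coordinates, since [emb] is continuous and
    composing it with [iota] gives back the projection. *)
Lemma iota_open x c (A : set (PSQ h)) : strip x ->
  (\forall p \near (x, c), strip p.1 -> A (iota p.1 p.2)) -> nbhs (iota x c) A.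
Proof.
move=> sx nA; apply/nbhs_proj.
pose emb (p : PST C) : (R * R) * C := ((\val p.1.1, p.1.2), p.2).
pose p0 : PST C := ((clampI x.1, x.2), c).
have cemb : emb @ p0 --> emb p0.
  apply: (@cvg_pair _ _ _ (nbhs p0) (nbhs (emb p0).1) (nbhs p0.2) _ _ _
    (fun p : PST C => (\val p.1.1, p.1.2)) snd); last exact: cvg_snd.
  apply: (@cvg_pair _ _ _ (nbhs p0) (nbhs (\val p0.1.1)) (nbhs p0.1.2) _ _ _
    (fun p : PST C => \val p.1.1) (fun p : PST C => p.1.2)).
    apply: (@continuous_comp _ _ _ (fun p : PST C => p.1.1) \val).
      by apply: (@cvg_comp _ _ _ fst fst); exact: cvg_fst.
    exact: initial_continuous.
  by apply: (@cvg_comp _ _ _ fst snd); [exact: cvg_fst|exact: cvg_snd].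
have embE : emb p0 = (x, c) by rewrite /emb [X in ((X, _), _)]clampI_id// -surjective_pairing.
have : \forall p \near p0, strip (emb p).1 -> A (iota (emb p).1 (emb p).2).
  have H : nbhs (emb p0) [set p | strip p.1 -> A (iota p.1 p.2)] by rewrite embE.
  exact: (cemb _ H).
apply: filterS => -[[s r] d] /=; rewrite /iota /= clampI_val; apply.
have := set_valP s.
by rewrite /unit_interval /strip /= in_itv.
Qed.

Definition srep (z : PSQ h) : (R * R) * C :=
  let p : PST C := repr z in ((\val p.1.1, p.1.2), p.2).

Lemma srep_strip z : strip (srep z).1.
Proof.
have := set_valP (repr z : PST C).1.1.
by rewrite /unit_interval /strip /= in_itv.
Qed.

Lemma srepK z : iota (srep z).1 (srep z).2 = z.
Proof.
rewrite -[RHS]reprK /iota /srep /= clampI_val.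
by case: (repr z) => [[s r] c].
Qed.

Lemma iota_eq x y c c' : strip x -> strip y ->
  (iota x c = iota y c' <-> exists n, y = shift x n /\ c' = hpow h (- n) c).
Proof.
move=> sx sy; rewrite projP; split.
  move=> [/= e1 [n [e2 e3]]]; exists n; split => //.
  rewrite /shift -e2 -(clampI_id sx) e1 clampI_id//; exact: surjective_pairing.
by move=> [n [-> ->]]; split => //; exists n.
Qed.

Lemma iota_shift x n c : iota (shift x n) (hpow h (- n) c) = iota x c.
Proof. by apply/esym/projP; split => //=; exists n. Qed.

Lemma qC_iota x c : strip x -> qC (iota x c) = qp x.
Proof.
move=> sx; pose p : PST C := repr (iota x c).
have -> : qC (iota x c) = qp (\val p.1.1, p.1.2) by [].
have : proj p = proj ((clampI x.1, x.2), c) by rewrite /proj /p reprK.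
move=> /projP[/= e1 [n [e2 _]]].
rewrite -(qp_shift (\val p.1.1, p.1.2) n) /shift /= -e2 e1 clampI_id//.
Qed.

Lemma suspension_iota (Psi : set (R * R)) x c : strip x ->
  pseudo_suspension (h := h) Psi (iota x c) <-> lft Psi x.
Proof.
by move=> sx; rewrite /pseudo_suspension /= qC_iota//; split => // -[].
Qed.

End Suspension.

(** * A metric on the quotient *)

Section SuspensionMetric.
Context {R : realType} {C : pseudoMetricType R} (h : homeo C).
Hypotheses (hC : hausdorff_space C) (C0 : [set: C] !=set0).
Implicit Types (x y : R * R) (a c : C) (t : R) (z w : PSQ h).

Let bump (r : R) : R := 1 - cos (2 * pi * r).

Let bump_ge0 r : 0 <= bump r.
Proof. by rewrite /bump; have := cos_le1 (2 * pi * r); lra. Qed.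

Let bump_le2 r : bump r <= 2.
Proof. by rewrite /bump; have := cos_geN1 (2 * pi * r); lra. Qed.

Let bump_continuous : continuous bump.
Proof.
move=> r; apply: cvgB; first exact: cvg_cst.
apply: (@continuous_comp _ _ _ (fun r => 2 * pi * r) cos); last exact: continuous_cos.
by apply: cvgM; [exact: cvg_cst|exact: cvg_id].
Qed.

(* [bump (r + t)] kills the jump of the floor, so this descends to a continuous
   function on the quotient. *)
Let probe t a x c : R := bump (x.2 + t) * capdist a (hpow h (Num.floor (x.2 + t)) c).

(** Replacing [x] by [x + n] raises the floor by [n], which cancels the power [- n] of [h] applied
    to the height; [bump] has period 1. *)
Let probe_iota t a x y c d : strip x -> strip y -> iota h x c = iota h y d ->
  probe t a x c = probe t a y d.
Proof.
move=> sx sy /iota_eq -/(_ sx sy)[n [-> ->]]; rewrite /probe /=.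
have fl : Num.floor (x.2 + t + n%:~R) = Num.floor (x.2 + t) + n.
  have /andP[f1 f2] := @floor_itv R (x.2 + t).
  by apply: floor_def; rewrite !intrD in f2 *; apply/andP; split; lra.
by rewrite addrAC /bump cos_intD fl -hpowD -addrA subrr addr0.
Qed.

Let probeQ t a z := probe t a (srep z).1 (srep z).2.

Let probeQE t a x c : strip x -> probeQ t a (iota h x c) = probe t a x c.
Proof. by move=> sx; apply: probe_iota => //; [exact: srep_strip|exact: srepK]. Qed.

Let probe_bnd t a x c : 0 <= probe t a x c <= bump (x.2 + t).
Proof.
rewrite mulr_ge0 ?capdist_ge0//= -[leRHS]mulr1.
by apply: ler_wpM2l => //; exact: capdist_le1.
Qed.

Let probe_bnd2 t a z w : `|probeQ t a z - probeQ t a w| <= 2.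
Proof.
have /andP[z0 z1] := probe_bnd t a (srep z).1 (srep z).2.
have /andP[w0 w1] := probe_bnd t a (srep w).1 (srep w).2.
have b1 := bump_le2 ((srep z).1.2 + t); have b2 := bump_le2 ((srep w).1.2 + t).
by rewrite ler_norml /probeQ; apply/andP; split; lra.
Qed.

Let gset t z w : set R := [set `|probeQ t a z - probeQ t a w| | a in [set: C]].
Let gap t z w : R := sup (gset t z w).

Let gset_ne t z w : gset t z w !=set0.
Proof. by case: C0 => a _; exists (`|probeQ t a z - probeQ t a w|); exists a. Qed.

Let gset_ub t z w : has_ubound (gset t z w).
Proof. by exists 2 => _ [a _ <-]; exact: probe_bnd2. Qed.

Let gap_ge t a z w : `|probeQ t a z - probeQ t a w| <= gap t z w.
Proof. by apply: ub_le_sup => //; exists a. Qed.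

Let gap_le t z w e : (forall a, `|probeQ t a z - probeQ t a w| <= e) -> gap t z w <= e.
Proof. by move=> H; apply: ge_sup => // _ [a _ <-]. Qed.

Let gap_ge0 t z w : 0 <= gap t z w.
Proof. by case: C0 => a _; apply: le_trans (gap_ge t a z w). Qed.

Let gapC t z w : gap t z w = gap t w z.
Proof. by congr sup; apply: eq_imagel => a _; rewrite distrC. Qed.

Let gap_tri t z w v : gap t z v <= gap t z w + gap t w v.
Proof.
apply: gap_le => a; apply: le_trans (ler_distD (probeQ t a w) _ _) _.
by apply: lerD; exact: gap_ge.
Qed.

(** A probe is blind where its [bump] vanishes, at integer values of [x.2 + t]. The offsets 0 and
    [1 / 2] are never blind at the same point, so together with the projection to the annulus they
    separate points. *)
Definition sdist z w : R :=
  `|(qC z).1 - (qC w).1| + `|(qC z).2 - (qC w).2| + gap 0 z w + gap (1 / 2) z w.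

Lemma sdist_ge0 z w : 0 <= sdist z w.
Proof. by rewrite /sdist !addr_ge0. Qed.

Lemma sdistC z w : sdist z w = sdist w z.
Proof. by rewrite /sdist (distrC (qC z).1) (distrC (qC z).2) !(gapC _ z). Qed.

Lemma sdist_tri z w v : sdist z v <= sdist z w + sdist w v.
Proof.
rewrite /sdist.
have := ler_distD (qC w).1 (qC z).1 (qC v).1.
have := ler_distD (qC w).2 (qC z).2 (qC v).2.
have := gap_tri 0 z w v; have := gap_tri (1 / 2) z w v; lra.
Qed.

Lemma sdist_eq0 z w : sdist z w = 0 <-> z = w.
Proof.
split; last first.
  move=> ->; rewrite /sdist !subrr !normr0.
  have g0 t : gap t w w = 0.
    apply/eqP; rewrite eq_le gap_ge0 andbT; apply: gap_le => a.
    by rewrite subrr normr0.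
  by rewrite !g0 !addr0.
move=> d0.
have p1 := normr_ge0 ((qC z).1 - (qC w).1); have p2 := normr_ge0 ((qC z).2 - (qC w).2).
have p3 := gap_ge0 0 z w; have p4 := gap_ge0 (1 / 2) z w.
have q1 : `|(qC z).1 - (qC w).1| = 0 by move: d0; rewrite /sdist; lra.
have q2 : `|(qC z).2 - (qC w).2| = 0 by move: d0; rewrite /sdist; lra.
have g1 : gap 0 z w = 0 by move: d0; rewrite /sdist; lra.
have g2 : gap (1 / 2) z w = 0 by move: d0; rewrite /sdist; lra.
have qzw : qC z = qC w.
  move/eqP: q1; rewrite normr_eq0 subr_eq0 => /eqP e1.
  move/eqP: q2; rewrite normr_eq0 subr_eq0 => /eqP e2.
  by rewrite [qC z]surjective_pairing e1 e2 -surjective_pairing.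
move: g1 g2 qzw; rewrite -(srepK z) -(srepK w) => {d0 p1 p2 p3 p4 q1 q2}.
have sx := srep_strip z; have sy := srep_strip w.
move: (srep z) (srep w) sx sy => [x c] [y d] /= sx sy g1 g2.
rewrite !qC_iota// => /(qp_inj sx sy)[n yE].
have yd : iota h y d = iota h x (hpow h n d).
  by rewrite -(iota_shift h x n) hpowNK yE.
move: g1 g2; rewrite yd => g1 g2.
(* The base point [a] is taken to be [hpow h k c] itself, so that the probe vanishes at the first
   point and therefore at the second. *)
have sep t : gap t (iota h x c) (iota h x (hpow h n d)) = 0 -> bump (x.2 + t) != 0 ->
    c = hpow h n d.
  move=> g0 b0; pose k := Num.floor (x.2 + t); pose a := hpow h k c.
  have := gap_ge t a (iota h x c) (iota h x (hpow h n d)).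
  rewrite g0 normr_le0 subr_eq0 !probeQE// => /eqP/(mulfI b0).
  rewrite -/k capdistxx => /esym/(capdist0_eq hC) e.
  by rewrite -(hpowNK h k c) -/a e hpowNK.
congr iota; have [b0|b0] := eqVneq (bump (x.2 + 0)) 0; last exact: sep g1 b0.
have [b1|b1] := eqVneq (bump (x.2 + 1 / 2)) 0; last exact: sep g2 b1.
have [i iE] : exists i : int, x.2 + 0 = i%:~R.
  by apply: cos_2pi_eq1; move: b0; rewrite /bump; lra.
have [j jE] : exists i : int, x.2 + 1 / 2 = i%:~R.
  by apply: cos_2pi_eq1; move: b1; rewrite /bump; lra.
have e2 : 2 * (j - i) = 1 :> int.
  apply/eqP; rewrite -(eqr_int R) intrM intrB -iE -jE.
  by apply/eqP; rewrite (_ : 2%:~R = 2)//; lra.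
by exfalso; lia.
Qed.

(** The estimate is uniform in [a], as the supremum in [gap] requires. Where [bump] vanishes, the
    probe is small because it is bounded by [bump]; elsewhere the floor is locally constant and
    [capdist_dist] bounds the change independently of [a]. *)
Let probe_near t x c e : 0 < e ->
  \forall p \near (x, c), forall a, `|probe t a x c - probe t a p.1 p.2| <= e.
Proof.
move=> e0.
have c2 : p.1.2 + t @[p --> (x, c)] --> x.2 + t.
  apply: cvgD; last exact: cvg_cst.
  by apply: (@cvg_comp _ _ _ fst snd); [exact: cvg_fst|exact: cvg_snd].
have cb : bump (p.1.2 + t) @[p --> (x, c)] --> bump (x.2 + t).
  by apply: continuous_cvg => //; exact: bump_continuous.
have e4 : 0 < e / 4 by rewrite divr_gt0.
have nb : \forall p \near (x, c), `|bump (x.2 + t) - bump (p.1.2 + t)| < e / 4.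
  have H : nbhs (bump (x.2 + t)) [set r : R | `|bump (x.2 + t) - r| < e / 4].
    exact: (@nbhsx_ballx R R^o).
  exact: (cb _ H).
have [b0|b0] := eqVneq (bump (x.2 + t)) 0.
  apply: filterS nb => p hp a.
  rewrite b0 sub0r normrN in hp.
  have /andP[x0 x1] := probe_bnd t a x c; have /andP[y0 y1] := probe_bnd t a p.1 p.2.
  rewrite b0 in x1; rewrite (ger0_norm (bump_ge0 _)) in hp.
  by rewrite ler_norml; apply/andP; split; lra.
pose k := Num.floor (x.2 + t).
have /andP[k1 k2] := @floor_itv R (x.2 + t); rewrite -/k in k1 k2.
have k3 : k%:~R < x.2 + t.
  rewrite lt_neqAle k1 andbT; apply/eqP => kE; move/eqP: b0; apply.
  by rewrite /bump -kE -(add0r k%:~R) cos_intD mulr0 cos0 subrr.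
have nk : \forall p \near (x, c), Num.floor (p.1.2 + t) = k.
  have H : \forall r \near x.2 + t, k%:~R < r /\ r < (k + 1)%:~R.
    by near=> r; split; near: r; [exact: lt_nbhsr|exact: lt_nbhsl].
  have H' : \forall p \near (x, c), k%:~R < p.1.2 + t /\ p.1.2 + t < (k + 1)%:~R.
    exact: (c2 _ H).
  apply: filterS H' => p [p1 p2].
  by apply: floor_def; rewrite (ltW p1) p2.
have nh : \forall p \near (x, c), ball (hpow h k c) (e / 4) (hpow h k p.2).
  have ch : hpow h k p.2 @[p --> (x, c)] --> hpow h k c.
    by apply: continuous_cvg; [exact: hpow_continuous|exact: cvg_snd].
  exact: (ch _ (nbhsx_ballx _ _ e4)).
apply: filterS3 nb nk nh => p h1 h2 h3 a.
rewrite /probe h2 -/k.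
have h4 := capdist_ball e4 h3.
have h5 := capdist_dist a (hpow h k c) (hpow h k p.2).
have u0 := capdist_ge0 a (hpow h k c); have u1 := capdist_le1 a (hpow h k c).
have b1 := bump_ge0 (p.1.2 + t); have b2 := bump_le2 (p.1.2 + t).
set u := capdist a _ in h5 u0 u1 *; set v := capdist a _ in h5 *.
set B := bump _ in h1 *; set B' := bump _ in h1 b1 b2 *.
have -> : B * u - B' * v = (B - B') * u + B' * (u - v) by ring.
apply: le_trans (ler_normD _ _) _; rewrite !normrM (ger0_norm u0) (ger0_norm b1).
have := normr_ge0 (B - B'); have := normr_ge0 (u - v).
nra.
Unshelve. all: by end_near. Qed.

Lemma sdist_near z e : 0 < e -> \forall w \near z, sdist z w < e.
Proof.
rewrite -(srepK z); have sx := srep_strip z; move: (srep z) sx => [x c] /= sx e0.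
apply: iota_open => //.
have e8 : 0 < e / 8 by rewrite divr_gt0.
have nq : \forall p \near (x, c), ball (qp x) (e / 8) (qp p.1).
  have cq : qp p.1 @[p --> (x, c)] --> qp x.
    by apply: continuous_cvg; [exact: continuous_qp|exact: cvg_fst].
  exact: (cq _ (nbhsx_ballx _ _ e8)).
apply: filterS3 nq (probe_near 0 x c e8) (probe_near (1 / 2) x c e8) => -[y d] /=.
move=> /ballR2P[q1 q2] p0 p1 sy; rewrite /sdist !qC_iota//.
have g0 : gap 0 (iota h x c) (iota h y d) <= e / 8.
  by apply: gap_le => a; rewrite !probeQE.
have g1 : gap (1 / 2) (iota h x c) (iota h y d) <= e / 8.
  by apply: gap_le => a; rewrite !probeQE.
lra.
Qed.

Lemma hausdorff_PSQ : hausdorff_space (PSQ h).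
Proof. exact: (separating_hausdorff sdist_eq0 sdistC sdist_tri sdist_near). Qed.

Lemma metrizable_PSQ (K : set (PSQ h)) : compact K -> metrizable_set R K.
Proof.
exact: (compact_metrizable sdist_ge0 sdist_eq0 sdistC sdist_tri sdist_near).
Qed.

End SuspensionMetric.

(** * The pseudo-suspension *)

Section MinimalCantor.
Context {R : realType} {C : pseudoMetricType R} (h : homeo C).
Hypotheses (cantC : cantor_like C) (C0 : [set: C] !=set0) (minh : minimal h).
Implicit Types (c : C) (n : int) (x y : R * R).

Let compC : compact [set: C]. Proof. by case: cantC. Qed.
Let hausC : hausdorff_space C. Proof. by case: cantC. Qed.

Lemma clopen_nbhs c (U : set C) : nbhs c U -> exists D, [/\ clopen D, D c & D `<=` U].
Proof.
case: cantC => _ _ _ zC nU.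
by have [D [Dc cD] DU] := @zero_dimensional_cvg _ c hausC zC compC U nU; exists D.
Qed.

Lemma clopen_preimage (D : set C) n : clopen D -> clopen (hpow h n @^-1` D).
Proof.
move=> [oD cD]; split.
  by apply: open_comp => // c _; exact: hpow_continuous.
by apply: preimage_closed => // c _; exact: hpow_continuous.
Qed.

(** The points whose orbit misses [D] form a closed invariant set that omits [d], so it is empty by
    minimality; compactness of [C] bounds the hitting times. *)
Lemma minimal_hits (D : set C) : open D -> D !=set0 ->
  exists N : nat, forall c, exists n, `|n| <= N /\ D (hpow h n c).
Proof.
move=> oD [d Dd].
pose A := ~` \bigcup_(n in [set: int]) (hpow h n @^-1` D).
have cA : closed A.
  apply: open_closedC; apply: bigcup_open => n _.
  by apply: open_comp => // c _; exact: hpow_continuous.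
have hA : hfun h @` A = A.
  apply/seteqP; split.
    move=> _ [c Ac <-] [n _ /= Dn]; apply: Ac; exists (n + 1) => //=.
    by rewrite hpowD.
  move=> c Ac; exists (hinv h c); last by rewrite hinvK.
  move=> [n _ /= Dn]; apply: Ac; exists (n - 1) => //=.
  by rewrite hpowD.
have A0 c : exists n, D (hpow h n c).
  apply: contrapT => nex; have [A0|AT] := minh cA hA.
    have : A c by move=> [n _ Dn]; apply: nex; exists n.
    by rewrite A0.
  have : A d by rewrite AT.
  by apply; exists 0.
have [|N _ NP] := (iffLR (compact_near_coveringP _) compC) _ \oo
    (fun (N : nat) c => exists n, `|n| <= N /\ D (hpow h n c)) _.
  move=> c _; have [n Dn] := A0 c.
  exists (hpow h n @^-1` D, [set N : nat | (`|n| <= N)%N]); last first.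
    by move=> [c' N] /= [Dc' nN]; exists n; split => //; lia.
  split; last by exists `|n|%N.
  by apply: hpow_continuous; exact: open_nbhs_nbhs.
by exists N => c; exact: (NP N (leqnn N) c I).
Qed.

(** The bounded hitting time [N] is applied to the orbit points at times [- M - N] and [M + N]. *)
Lemma minimal_recurrent (D : set C) c (M : int) : open D -> D !=set0 ->
  exists n1 n2, [/\ n1 <= - M, M <= n2, D (hpow h n1 c) & D (hpow h n2 c)].
Proof.
move=> oD D0; have [N NP] := minimal_hits oD D0.
have [n1 [b1 D1]] := NP (hpow h (- M - N%:Z) c).
have [n2 [b2 D2]] := NP (hpow h (M + N%:Z) c).
exists (n1 + (- M - N%:Z)), (n2 + (M + N%:Z)).
by split; [lia|lia|rewrite hpowD|rewrite hpowD].
Qed.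

Lemma hpow_aperiodic c n : hpow h n c = c -> n = 0.
Proof.
suff key (k : nat) : hpow h k.+1 c <> c.
  case: n => [[|k]|k] // e; first by case: (key k).
  case: (key k); rewrite -[in LHS]e; have -> : Negz k = - (k.+1)%:Z by rewrite NegzE.
  by rewrite hpowK.
(* A periodic orbit is finite, closed and invariant, hence all of [C]; but no point of a Cantor set
   is isolated. *)
move=> per; pose S := (fun i : nat => hpow h i c) @` `I_k.+1.
have fS : finite_set S by apply: finite_image; exact: finite_II.
have clf (G : set C) : finite_set G -> closed G.
  by move=> fG; apply: compact_closed => //; exact: finite_compact.
have hS : hfun h @` S = S.
  apply/seteqP; split.
    move=> _ [_ [i /= ik <-] <-]; have [e|ne] := eqVneq i k.
      by exists 0%N => //=; rewrite e -[in LHS]per.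
    by exists i.+1 => //=; lia.
  move=> _ [[|i] /= ik <-].
    by exists (hpow h k c) => //; exists k => //=.
  by exists (hpow h i c) => //; exists i => //=; lia.
have [S0|ST] := minh (clf _ fS) hS.
  have : S c by exists 0%N.
  by rewrite S0.
case: cantC => -[_ lim] _ _ _.
have : limit_point [set: C] c by rewrite lim.
have cG : closed (S `\` [set c]) by apply: clf; exact: finite_setD.
move=> /(_ (~` (S `\` [set c])))[|c' [ne _ nS]].
  by apply: open_nbhs_nbhs; split; [exact: closed_openC|move=> [_]; apply].
by apply: nS; split; [rewrite ST|exact/eqP].
Qed.

Lemma iota_continuousl c : continuous (fun x => iota h x c).
Proof.
move=> x; apply: (@continuous_comp _ _ _ (fun x => (x, c)) (fun p => iota h p.1 p.2));
  last exact: iota_continuous.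
by apply: (@cvg_pair _ _ _ (nbhs x) (nbhs x) (nbhs c) _ _ _ id (cst c));
  [exact: cvg_id|exact: cvg_cst].
Qed.

Lemma iota_continuousr x : continuous (fun c => iota h x c).
Proof.
move=> c; apply: (@continuous_comp _ _ _ (fun c => (x, c)) (fun p => iota h p.1 p.2));
  last exact: iota_continuous.
by apply: (@cvg_pair _ _ _ (nbhs c) (nbhs x) (nbhs c) _ _ _ (cst x) id);
  [exact: cvg_cst|exact: cvg_id].
Qed.

Lemma iota_inj c x y : strip x -> strip y -> iota h x c = iota h y c -> x = y.
Proof.
move=> sx sy /iota_eq -/(_ sx sy)[n [-> /esym/hpow_aperiodic n0]].
have -> : n = 0 by lia.
by rewrite shift0.
Qed.

Variable Psi : set (R * R).
Hypotheses (intPsi : Psi `<=` @annulus_int R) (essPsi : essential Psi).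
Hypothesis contPsi : continuum R Psi.

Let cPsi : compact Psi. Proof. by case: contPsi. Qed.
Let coPsi : connected Psi. Proof. by case: contPsi. Qed.
Let Psi0 : Psi !=set0. Proof. by case: contPsi. Qed.
Let clPsi : closed Psi.
Proof. by apply: compact_closed => //; exact: hausdorffR2. Qed.
Let X := pseudo_suspension (h := h) Psi.
Let hausQ : hausdorff_space (PSQ h). Proof. exact: hausdorff_PSQ. Qed.

Let XP z : X z -> exists x c, lft Psi x /\ z = iota h x c.
Proof.
move=> Xz; exists (srep z).1, (srep z).2; split; last by rewrite srepK.
by apply/(suspension_iota h Psi (srep z).2 (srep_strip z)); rewrite srepK.
Qed.

Let Xiota x c : lft Psi x -> X (iota h x c).
Proof. by move=> lx; apply/suspension_iota => //; exact: lft_strip lx. Qed.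

Lemma suspension_compact : compact X.
Proof.
have -> : X = (fun p => iota h p.1 p.2) @`
    ((lft Psi `&` [set x | 0 <= x.2 <= 1]) `*` [set: C]).
  apply/seteqP; split.
    move=> z /XP[x [c [lx ->]]]; have [n [ln un]] := lft_unit lx.
    by exists (shift x n, hpow h (- n) c) => //=; rewrite iota_shift.
  by move=> _ [[x c] /= [[lx _] _] <-]; exact: Xiota.
apply: continuous_compact.
  by apply: continuous_subspaceT; exact: iota_continuous.
by apply: compact_setX => //; exact: compact_lft.
Qed.

Lemma suspension_connected : connected X.
Proof.
move=> B [z0 Bz0] [C1 oC1 BE1] [C2 cC2 BE2].
pose E x : set C := [set c | B (iota h x c)].
have B1 x c : lft Psi x -> C1 (iota h x c) -> B (iota h x c).
  by move=> lx Cx; rewrite BE1; split => //; exact: Xiota.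
have B2 x c : lft Psi x -> C2 (iota h x c) -> B (iota h x c).
  by move=> lx Cx; rewrite BE2; split => //; exact: Xiota.
have Bn1 x c : B (iota h x c) -> C1 (iota h x c) by rewrite BE1 => -[].
have Bn2 x c : B (iota h x c) -> C2 (iota h x c) by rewrite BE2 => -[].
(* A tube argument: both [B] and its complement are relatively open, and compactness of [C] gives
   one neighbourhood of [x] good for all heights. *)
have Eloc x : lft Psi x -> \forall y \near x, lft Psi y -> E y = E x.
  move=> lx.
  have := (iffLR (compact_near_coveringP _) compC) _ (nbhs x)
    (fun y c => lft Psi y -> (B (iota h y c) <-> B (iota h x c))) _.
  move=> H; have {}H : \forall y \near x, [set: C] `<=`
      (fun c => lft Psi y -> (B (iota h y c) <-> B (iota h x c))).
    apply: H => c _.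
    have [Bc|nBc] := pselect (B (iota h x c)).
      have : nbhs (x, c) [set p | C1 (iota h p.1 p.2)].
        by apply: iota_continuous; apply: open_nbhs_nbhs; split => //; exact: Bn1.
      move=> [[U1 U2] /= [n1 n2] UC]; exists (U2, U1) => // -[c' y] /= [u2 u1] ly.
      split=> _; apply: B1 => //; last exact: (UC (y, c')).
      by apply: (UC (x, c')); split => //; exact: nbhs_singleton.
    have : nbhs (x, c) [set p | (~` C2) (iota h p.1 p.2)].
      apply: iota_continuous; apply: open_nbhs_nbhs; split.
        exact: closed_openC.
      by move=> /(B2 _ _ lx).
    move=> [[U1 U2] /= [n1 n2] UC]; exists (U2, U1) => // -[c' y] /= [u2 u1] ly.
    split=> /Bn2.
      by move=> h2; case: (UC (y, c')).
    by move=> h2; case: (UC (x, c')) => //; split => //; exact: nbhs_singleton.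
  apply: filterS H => y H ly; apply/seteqP; split=> c /=.
    by move/(H c I ly).
  by move=> Bx; apply/(H c I ly).
have ES x c : E (shift x 1) c <-> E x (hpow h 1 c).
  by rewrite /E /= -(iota_shift h x 1) hpowNK.
have Ecst x y : lft Psi x -> lft Psi y -> E x = E y.
  apply: (@equivariantly_constant R Psi cPsi coPsi intPsi essPsi) => // u v _ _.
  split=> e; apply/seteqP; split=> c.
  - by move/ES; rewrite e => /ES.
  - by move/ES; rewrite -e => /ES.
  - have : E (shift u 1) (hpow h (- 1) c) <-> E (shift v 1) (hpow h (- 1) c) by rewrite e.
    by rewrite !ES hpowK => -[].
  - have : E (shift u 1) (hpow h (- 1) c) <-> E (shift v 1) (hpow h (- 1) c) by rewrite e.
    by rewrite !ES hpowK => -[].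
have [x0 [c0 [l0 z0E]]] : exists x c, lft Psi x /\ z0 = iota h x c.
  by apply: XP; move: Bz0; rewrite BE1 => -[].
have l1 : lft Psi (shift x0 1) by exact/lft_shift.
(* Constancy of [E] compares the slices at [x0] and [x0 + 1], and these differ by [h]; so the slice
   is invariant and minimality applies. *)
have inv c : E x0 c <-> E x0 (hfun h c) by rewrite {1}(Ecst _ _ l0 l1) ES.
have cE : closed (E x0).
  have -> : E x0 = (fun c => iota h x0 c) @^-1` C2.
    by apply/seteqP; split=> c /=; [exact: Bn2|exact: (B2 _ _ l0)].
  by apply: preimage_closed => // c _; exact: iota_continuousr.
have hE : hfun h @` E x0 = E x0.
  apply/seteqP; split; first by move=> _ [c Ec <-]; exact: (iffLR (inv c)).
  move=> c Ec; exists (hinv h c); last by rewrite hinvK.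
  by apply: (iffRL (inv _)); rewrite hinvK.
have [E0|ET] := minh cE hE.
  have : E x0 c0 by rewrite /E /= -z0E.
  by rewrite E0.
rewrite eqEsubset; split; first by rewrite BE1 => z [].
move=> z /XP[x [c [lx ->]]].
have : E x c by rewrite (Ecst _ _ lx l0) ET.
by [].
Qed.

Lemma suspension_continuum : continuum R X.
Proof.
split; [|exact: suspension_compact|exact: suspension_connected|].
  case: Psi0 => z /(Psi_lft intPsi)[x lx _]; case: C0 => c _.
  by exists (iota h x c); exact: Xiota.
by apply: metrizable_PSQ => //; exact: suspension_compact.
Qed.

Hypothesis ccPsi : circularly_chainable Psi.

Lemma continuum_lift K : K `<=` X -> K !=set0 -> compact K -> connected K -> K <> X ->
  exists c B, [/\ compact B, connected B, B `<=` lft Psi & K = (fun x => iota h x c) @` B].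
Proof.
move=> KX [k0 Kk0] cK coK KnX.
have clK : closed K by exact: compact_closed.
have [y [d [ly nKy]]] : exists y d, lft Psi y /\ ~ K (iota h y d).
  apply: contrapT => nex; apply: KnX; apply/seteqP; split => // z /XP[x [c [lx ->]]].
  by apply: contrapT => nK; apply: nex; exists x, c.
have [e [D [e0 [oD cD] Dd nK]]] : exists (e : R) (D : set C), [/\ 0 < e, clopen D, D d &
    forall x c, ball y e x -> D c -> ~ K (iota h x c)].
  have : nbhs (y, d) [set p | (~` K) (iota h p.1 p.2)].
    by apply: iota_continuous; apply: open_nbhs_nbhs; split => //; exact: closed_openC.
  move=> [[U1 U2] /= [n1 n2] UK].
  have [D [cD Dd DU]] := clopen_nbhs n2.
  move: n1; rewrite -nbhs_ballE => -[e /= e0 eU].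
  by exists e, D; split => // x c /eU xU /DU cU; apply: (UK (x, c)).
have [N [L LC]] := lifted_chain_exists cPsi coPsi intPsi essPsi Psi0 ccPsi e0.
have N0 := lc_pos LC.
have [a La] := lc_cov LC ly.
have [x0 [c1 [l0 k0E]]] := XP (KX _ Kk0).
have [m0 L0] := lc_cov LC l0.
(* The margin [|m0 - a| + 1] makes the blocked indices [a + N * n1] and [a + N * n2] enclose
   [m0]. *)
have [n1 [n2 [n1M n2M D1 D2]]] := @minimal_recurrent D c1 (`|m0 - a| + 1) oD (ex_intro _ d Dd).
pose b1 := a + N * n1; pose b2 := a + N * n2.
(* For heights in this clopen neighbourhood of [c1] the same two links are blocked. *)
pose D' := hpow h n1 @^-1` D `&` hpow h n2 @^-1` D.
have cD' : clopen D' by apply: clopenI; apply: clopen_preimage.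
have D'c1 : D' c1 by [].
have miss n x c : D (hpow h n c) -> K (iota h x c) -> ~ L (a + N * n) x.
  move=> Dc Kx /(lc_shift LC (- n)); rewrite mulrN addrK => /(lc_mesh LC La) bx.
  apply: (nK _ _ bx Dc); rewrite -[in hpow _ n _](opprK n) iota_shift//.
pose ins m := b1 < m < b2.
have ins0 : ins m0 by rewrite /ins /b1 /b2; nia.
have insP x c m m' : D' c -> K (iota h x c) -> L m x -> L m' x -> ins m -> ins m'.
  move=> [Dc1 Dc2] Kx Lm Lm'; have := lc_adj LC Lm Lm'.
  have : m' <> b1 by move=> E; apply: (miss _ _ _ Dc1 Kx); rewrite -/b1 -E.
  have : m' <> b2 by move=> E; apply: (miss _ _ _ Dc2 Kx); rewrite -/b2 -E.
  by rewrite /ins; lia.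
have [U oU UE] := lc_union_open LC ins.
have [U' oU' UE'] := lc_union_open LC (fun m => ~ ins m).
have UP x : lft Psi x -> U x -> exists2 m, ins m & L m x.
  move=> lx Ux; have : (lft Psi `&` U) x by [].
  by rewrite -UE.
have UN x c : D' c -> K (iota h x c) -> lft Psi x -> (U x <-> ~ U' x).
  move=> Dc Kx lx; split.
    move=> /(UP _ lx)[m im Lm] U'x; have : (lft Psi `&` U') x by [].
    by rewrite -UE' => -[m' nm' Lm']; apply: nm'; exact: (insP x c m m').
  move=> nU'; have [m Lm] := lc_cov LC lx.
  have [im|im] := pselect (ins m).
    have : [set x | exists2 m, ins m & L m x] x by exists m.
    by rewrite UE => -[].
  case: nU'; have : [set x | exists2 m, ~ ins m & L m x] x by exists m.
  by rewrite UE' => -[].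
have [k kP] := chain_bounded LC b1 b2.
have Ubnd x : lft Psi x -> U x -> `|x.2| <= k%:R.
  by move=> lx /(UP _ lx)[m im Lm]; apply: (kP m) => //; move: im; rewrite /ins; lia.
(* The part of [K] inside the window and at heights in [F] is compact, and also open in [K] because
   [F] is open and the window is bounded by blocked links. Being nonempty, it is all of the
   connected [K]. *)
have cover (F : set C) : clopen F -> F c1 -> F `<=` D' -> forall z, K z ->
    exists x c, [/\ lft Psi x, U x, F c & z = iota h x c].
  move=> [oF cF] Fc1 FD.
  pose Bh := [set p : (R * R) * C | lft Psi p.1] `&` [set p | (~` U') p.1] `&`
    [set p | F p.2] `&` [set p | K (iota h p.1 p.2)].
  have BhP x c : Bh (x, c) -> [/\ lft Psi x, U x, F c & K (iota h x c)].
    move=> [[[/= lx nU] Fc] Kx]; split => //.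
    by apply/(UN x c) => //; exact: FD.
  have cBh : compact Bh.
    apply: (@subclosed_compact _ _ ((lft Psi `&` [set x | - k%:R <= x.2 <= k%:R]) `*` [set: C])).
    - apply: closedI; last first.
        by apply: preimage_closed => // p _; exact: iota_continuous.
      apply: closedI; last by apply: (@preimage_closed _ _ snd F) => // p _; exact: cvg_snd.
      apply: closedI.
        apply: (@preimage_closed _ _ fst (lft Psi)); last exact: closed_lft.
        by move=> p _; exact: cvg_fst.
      apply: (@preimage_closed _ _ fst (~` U')); last exact: open_closedC.
      by move=> p _; exact: cvg_fst.
    - by apply: compact_setX => //; exact: compact_lft.
    - move=> [x c] /BhP[lx Ux _ _]; split => //; split => //=.
      by rewrite -ler_norml; exact: Ubnd.
  pose K1 := (fun p => iota h p.1 p.2) @` Bh.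
  have clK1 : closed K1.
    apply: compact_closed => //; apply: continuous_compact => //.
    by apply: continuous_subspaceT; exact: iota_continuous.
  have K1K : K1 `<=` K by move=> _ [p [_ Kp] <-].
  have K1E : K1 = K.
    apply: coK.
    - exists (iota h x0 c1); exists (x0, c1) => //; do 3?split => //=.
        apply/(UN x0 c1) => //; first by rewrite -k0E.
        have : [set x | exists2 m, ins m & L m x] x0 by exists m0.
        by rewrite UE => -[].
      by rewrite -k0E.
    - exists (interior [set z | K z -> K1 z]); first exact: open_interior.
      apply/seteqP; split=> z; last first.
        by move=> [Kz iz]; exact: (interior_subset iz).
      move=> K1z; split; first exact: K1K.
      case: K1z => -[x c] /BhP[lx Ux Fc Kx] <- /=.
      rewrite /interior; apply: iota_open; first exact: lft_strip lx.
      exists (U, F); first by split; apply: open_nbhs_nbhs.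
      move=> [x' c'] /= [Ux' Fc'] sx' Kx'; exists (x', c') => //.
      have lx' : lft Psi x' by apply/(suspension_iota h Psi c') => //; exact: KX.
      do 3?split => //=; apply/(UN x' c') => //; exact: FD.
    - by exists K1 => //; apply/seteqP; split=> z; [move=> K1z; split => //; exact: K1K|case].
  move=> z; rewrite -K1E => -[[x c] /BhP[lx Ux Fc Kx] <-]; exists x, c; split => //.
pose B := lft Psi `&` ~` U' `&` (fun x => iota h x c1) @^-1` K.
have Bl : B `<=` lft Psi by move=> x [[]].
have cB : compact B.
  apply: (@bounded_compact_lft _ _ k%:R _ clPsi) => //.
    apply: closedI; last by apply: preimage_closed => // x _; exact: iota_continuousl.
    by apply: closedI; [exact: closed_lft|exact: open_closedC].
  by move=> x [[lx nU] Kx]; apply: Ubnd => //; apply/(UN x c1).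
have KB : K = (fun x => iota h x c1) @` B.
  apply/seteqP; split; last by move=> _ [x [_ Kx] <-].
  move=> z Kz; have [x [c [lx Ux _ zE]]] := cover D' cD' D'c1 (fun _ => id) _ Kz.
  pose q := (k + k)%N.
  (* Points of the window have second coordinate at most [k] in absolute value, so two
     representatives of [z] there differ by a translation of size at most [q = 2 k]. A clopen [F]
     avoiding the finitely many other possible heights leaves only [c1]. *)
  pose S := (fun i : nat => hpow h (- (i%:Z - q%:Z)) c) @` `I_(q + q).+1 `\` [set c1].
  have clS : closed S.
    apply: compact_closed => //; apply: finite_compact; apply: finite_setD.
    by apply: finite_image; exact: finite_II.
  have [F [cF Fc1 FS]] : exists F, [/\ clopen F, F c1 & F `<=` D' `&` ~` S].
    apply: clopen_nbhs; apply: open_nbhs_nbhs; split.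
      by apply: openI; [case: cD'|exact: closed_openC].
    by split => // -[_]; apply.
  have [x' [c' [lx' Ux' Fc' zE']]] := cover F cF Fc1 (fun _ Fc => (FS _ Fc).1) _ Kz.
  move: zE'; rewrite zE => /iota_eq -/(_ (lft_strip lx) (lft_strip lx'))[n [xE cE]].
  have nq : `|n| <= q%:Z.
    have h1 := Ubnd _ lx Ux; have h2 := Ubnd _ lx' Ux'; rewrite xE /= in h2.
    have : `|n%:~R| <= q%:R :> R.
      by move: h1 h2; rewrite /q natrD !ler_norml => /andP[? ?] /andP[? ?]; apply/andP; split; lra.
    by rewrite -intr_norm pmulrn ler_int.
  have c'E : c' = c1.
    apply: contrapT => ne; case: (FS _ Fc') => _; apply; split => //.
    exists `|(n + q%:Z)%R|%N => /=; first lia.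
    by rewrite cE; congr hpow; lia.
  exists x'; last by rewrite -c'E cE xE iota_shift.
  have Kx' : K (iota h x' c1) by rewrite -c'E cE xE iota_shift -zE.
  by split => //; split => //; apply/(UN x' c1).
exists c1, B; split => //.
apply: (@connected_inj_image _ _ (fun x => iota h x c1) B hausQ _ _ hausdorffR2 cB).
- by move=> x _; exact: iota_continuousl.
- move=> x x' /set_mem[[/lft_strip sx _] _] /set_mem[[/lft_strip sx' _] _].
  exact: iota_inj.
- by rewrite -KB.
Qed.

Hypothesis hiPsi : hereditarily_indecomposable R Psi.

(** By connectedness, the indices of links meeting [B] form an interval, and consecutive links meet
    inside [B]. Renumbered from 0, these links form a finite chain. *)
Lemma lifted_chainable c B : compact B -> connected B -> B !=set0 -> B `<=` lft Psi ->
  chainable ((fun x => iota h x c) @` B).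
Proof.
move=> cB coB [x0 Bx0] Bl V oV KV; set f := fun x => iota h x c.
have clB : closed B by apply: compact_closed => //; exact: hausdorffR2.
have fi x y : B x -> B y -> f x = f y -> x = y.
  by move=> /Bl/lft_strip sx /Bl/lft_strip sy; exact: iota_inj.
have [W [W0 VW0 <-]|x Bx|e e0 eP] := @lebesgue_number R _ B [set f @^-1` W | W in V] cB.
- by apply: open_comp; [move=> x _; exact: iota_continuousl|exact: oV].
- have [W VW Wx] : (\bigcup_(W in V) W) (f x) by apply: KV; exists x.
  by exists (f @^-1` W) => //; exists W.
have [N [L LC]] := lifted_chain_exists cPsi coPsi intPsi essPsi Psi0 ccPsi e0.
have [q qP] : exists q : nat, forall x m, B x -> L m x -> `|m| <= q%:Z.
  have [|q _ qP] := (iffRL (near_covering_withinP _) (iffLR (compact_near_coveringP _) cB))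
      _ \oo (fun (q : nat) x => forall m, L m x -> `|m| <= q%:Z) _.
    move=> x Bx; have [m Lm] := lc_cov LC (Bl _ Bx).
    have [U oU LE] := lc_open LC m.
    exists (U, [set q : nat | (`|m|.+1 <= q)%N]); last first.
      move=> [x' q] /= [Ux' mq] Bx' m' Lm'.
      have Lm2 : L m x' by rewrite LE; split => //; exact: Bl.
      by have := lc_adj LC Lm' Lm2; lia.
    split; last by exists `|m|.+1.
    by apply: open_nbhs_nbhs; split => //; move: Lm; rewrite LE => -[].
  by exists q => x m Bx; exact: (qP q (leqnn q) x Bx).
pose meets (i : nat) := `[< exists2 x, B x & L (i%:Z - q%:Z) x >].
have ex0 : exists i, meets i.
  have [m Lm] := lc_cov LC (Bl _ Bx0); have mq := qP _ _ Bx0 Lm.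
  exists `|(m + q%:Z)%R|%N; apply/asboolP; exists x0 => //.
  by rewrite (_ : _ - _ = m)//; lia.
have bnd i : meets i -> (i <= q + q)%N.
  by move=> /asboolP[x Bx /(qP _ _ Bx)]; lia.
have [i0 m0 min0] := ex_minnP ex0; have [i1 m1 max1] := ex_maxnP ex0 bnd.
have i01 : (i0 <= i1)%N by exact: min0.
pose idx (i : nat) : int := i0%:Z + i%:Z - q%:Z.
pose n := (i1 - i0).+1.
have meetn i : (i < n)%N -> exists2 x, B x & L (idx i) x.
  rewrite /n => iln; apply: contrapT => nex.
  have nb x : B x -> ~ L (idx i) x by move=> Bx Lx; apply: nex; exists x.
  move/asboolP: m0 => [y0 By0 Ly0]; move/asboolP: m1 => [y1 By1 Ly1].
  have [H|H] := chain_cut LC coB Bl nb.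
    have := H _ _ By1 Ly1; rewrite /idx => h1.
    have ie : i = (i1 - i0)%N by lia.
    by lia.
  have := H _ _ By0 Ly0; rewrite /idx; lia.
have covn x m : B x -> L m x -> exists2 i, (i < n)%N & m = idx i.
  move=> Bx Lm; have mq := qP _ _ Bx Lm.
  have mm : meets `|(m + q%:Z)%R|%N.
    apply/asboolP; exists x => //.
    by rewrite (_ : _ - _ = m)//; lia.
  have h1 := min0 _ mm; have h2 := max1 _ mm.
  by exists (`|(m + q%:Z)%R|%N - i0)%N; rewrite /n /idx; lia.
pose U i := ~` (f @` (B `\` L (idx i))).
have UE i x : B x -> (U i (f x) <-> L (idx i) x).
  move=> Bx; split.
    by move=> nU; apply: contrapT => nL; apply: nU; exists x.
  by move=> Lx [y [By nLy] /(fi _ _ By Bx) yx]; apply: nLy; rewrite yx.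
exists n, U; split.
  split.
  - move=> i; apply: closed_openC; apply: compact_closed => //.
    apply: continuous_compact.
      by apply: continuous_subspaceT; exact: iota_continuousl.
    have [G oG LE] := lc_open LC (idx i).
    have -> : B `\` L (idx i) = B `&` ~` G.
      rewrite LE; apply/seteqP; split=> x [Bx nG]; split => // Gx; apply: nG.
        by split => //; exact: Bl.
      by case: Gx.
    by apply: compact_closedI => //; exact: open_closedC.
  - move=> _ [x Bx <-]; have [m Lm] := lc_cov LC (Bl _ Bx).
    have [i iln mE] := covn _ _ Bx Lm.
    by exists i => //; apply/UE => //; rewrite -mE.
  - move=> i iln; have [x Bx Lx] := meetn _ iln.
    have [_ [W VW <-] sub] := eP _ Bx; exists W => // z [Uz [y By yz]].
    rewrite -yz in Uz *; move/(UE i _ By): Uz => Ly.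
    by apply: sub; exact: (lc_mesh LC Lx Ly).
move=> i j iln jn; split.
  move=> [z [[Ui Uj] [x Bx xz]]]; rewrite -xz in Ui Uj.
  move/(UE _ _ Bx): Ui => Li; move/(UE _ _ Bx): Uj => Lj.
  by have := lc_adj LC Li Lj; rewrite /idx /nat_adj; lia.
(* If the two links had no common point in [B], the links up to [idx k] and those beyond would
   disconnect [B]. *)
have key k : (k.+1 < n)%N -> U k `&` U k.+1 `&` f @` B !=set0.
  move=> kn; apply: contrapT => nex.
  have [y0 By0 Ly0] := meetn _ (ltnW kn); have [y1 By1 Ly1] := meetn _ kn.
  have [||H|H] := @chain_split _ _ _ _ _ LC B (fun m => m <= idx k) (fun m => idx k < m) coB Bl.
  - by move=> m x _ _; have [] := leP m (idx k); [left|right].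
  - move=> m m' x Bx Lm Lm' mk km; apply: nex; exists (f x); split; last by exists x.
    have adj := lc_adj LC Lm Lm'.
    split; apply/UE => //; first by rewrite (_ : idx k = m)//; lia.
    by rewrite (_ : idx k.+1 = m')//; move: mk km adj; rewrite /idx; lia.
  - by have := H _ _ By1 Ly1; rewrite /idx; lia.
  - by have := H _ _ By0 Ly0; rewrite /idx; lia.
move=> /andP[ij ji].
have [e1|[e1|e1]] : i = j \/ j = i.+1 \/ i = j.+1 by lia.
- have [x Bx Lx] := meetn _ iln; rewrite -e1; exists (f x); split; last by exists x.
  by split; apply/UE.
- by rewrite e1; apply: key; rewrite -e1.
- by rewrite e1 (setIC (U j.+1)); apply: key; rewrite -e1.
Qed.

(** Two proper pieces covering a continuum [K] must meet. Pulled back to the lift they become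
    meeting continua, hence nested, so one piece is all of [K]. *)
Lemma lifted_hereditarily_indecomposable c B : compact B -> B `<=` lft Psi ->
  hereditarily_indecomposable R ((fun x => iota h x c) @` B).
Proof.
move=> cB Bl K [KB [K0 cK coK mK]] [A1 [A2 [[[AK1 [_ cA1 coA1 _]] nA1 _]
  [[AK2 [_ cA2 coA2 _]] nA2 _] KE]]].
set f := fun x => iota h x c in KB.
have cl (A : set (PSQ h)) : compact A -> closed A by exact: compact_closed.
pose G (A : set (PSQ h)) := B `&` f @^-1` A.
have fG A : A `<=` K -> f @` G A = A.
  move=> AK; apply/seteqP; split; first by move=> _ [x [_ Ax] <-].
  move=> z Az; have [x Bx xz] := KB _ (AK _ Az).
  by exists x => //; split => //=; rewrite xz.
have cG A : compact A -> compact (G A).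
  move=> cA; apply: compact_closedI => //; apply: preimage_closed; last exact: cl.
  by move=> x _; exact: iota_continuousl.
have coG A : A `<=` K -> compact A -> connected A -> connected (G A).
  move=> AK cA coA.
  apply: (@connected_inj_image _ _ f (G A) hausQ _ _ hausdorffR2 (cG _ cA)).
  - by move=> x _; exact: iota_continuousl.
  - move=> x y /set_mem[/Bl/lft_strip sx _] /set_mem[/Bl/lft_strip sy _].
    exact: iota_inj.
  - by rewrite fG.
have Gl A : G A `<=` lft Psi by move=> x [/Bl].
have meets : A1 `&` A2 !=set0.
  apply: contrapT => /nonemptyPn dis.
  have [||s|s] := @connected_closed_split _ K A1 A2 coK (cl _ cA1) (cl _ cA2).
  - by rewrite -KE.
  - by rewrite -setIA dis setI0.
  - by apply: nA1; apply/seteqP.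
  - by apply: nA2; apply/seteqP.
have GG : G A1 `&` G A2 !=set0.
  case: meets => z [A1z A2z]; have [x Bx xz] := KB _ (AK1 _ A1z).
  by exists x; split; split => //=; rewrite xz.
have [s|s] := lifted_nested intPsi essPsi contPsi ccPsi hiPsi (cG _ cA1)
    (coG _ AK1 cA1 coA1) (Gl A1) (cG _ cA2) (coG _ AK2 cA2 coA2) (Gl A2) GG.
  apply: nA2; apply/seteqP; split => // z; rewrite KE => -[|//].
  by rewrite -(fG _ AK1) => -[x /s[_ A2x] <-].
apply: nA1; apply/seteqP; split => // z; rewrite KE => -[//|].
by rewrite -(fG _ AK2) => -[x /s[_ A1x] <-].
Qed.

Lemma proper_is_pseudo_arc K : proper_subcontinuum R X K -> is_pseudo_arc R K.
Proof.
move=> [[KX contK] KnX ndK]; case: (contK) => K0 cK coK _.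
have [c [B [cB coB Bl KE]]] := continuum_lift KX K0 cK coK KnX.
split => //; rewrite KE.
  apply: lifted_chainable => //.
  by case: K0 => z; rewrite KE => -[x Bx _]; exists x.
exact: lifted_hereditarily_indecomposable.
Qed.

(** Two proper pieces each lie in a single leaf, and their projections cover [Psi]. The projections
    then meet and are nested, so one of them would be all of [Psi], against [lifted_not_full]. *)
Lemma suspension_indecomposable : indecomposable R X.
Proof.
move=> [A1 [A2 [[[AX1 [A10 cA1 coA1 _]] nA1 _] [[AX2 [A20 cA2 coA2 _]] nA2 _] XE]]].
have [c [B [cB coB Bl AE]]] := continuum_lift AX1 A10 cA1 coA1 nA1.
have [d [D [cD coD Dl AE']]] := continuum_lift AX2 A20 cA2 coA2 nA2.
have B0 : B !=set0 by case: A10 => z; rewrite AE => -[x Bx _]; exists x.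
have D0 : D !=set0 by case: A20 => z; rewrite AE' => -[x Dx _]; exists x.
have cov : Psi `<=` qp @` B `|` qp @` D.
  move=> z Pz; have [x lx xz] := Psi_lft intPsi Pz; rewrite -xz.
  have : X (iota h x c) by exact: Xiota.
  rewrite XE => -[]; [rewrite AE|rewrite AE'] => -[y yB] /(congr1 (@qC R C h)).
    by rewrite !qC_iota; [move=> <-; left; exists y|exact: lft_strip lx|exact: lft_strip (Bl _ yB)].
  by rewrite !qC_iota; [move=> <-; right; exists y|exact: lft_strip lx|exact: lft_strip (Dl _ yB)].
have s1 := qp_subcontinuum contPsi B0 cB coB Bl.
have s2 := qp_subcontinuum contPsi D0 cD coD Dl.
have [z1 P1 n1] := lifted_not_full intPsi essPsi contPsi ccPsi hiPsi cB coB Bl.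
have [z2 P2 n2] := lifted_not_full intPsi essPsi contPsi ccPsi hiPsi cD coD Dl.
have meets : qp @` B `&` qp @` D !=set0.
  apply: contrapT => /nonemptyPn dis.
  have [||s|s] := @connected_closed_split _ Psi (qp @` B) (qp @` D) coPsi (closed_qp cB) (closed_qp cD).
  - exact: cov.
  - by rewrite -setIA dis setI0.
  - exact: n1 (s _ P1).
  - exact: n2 (s _ P2).
have [s|s] := subcontinua_nested contPsi hiPsi s1 s2 meets.
  by apply: n2; case: (cov _ P2) => // /s.
by apply: n1; case: (cov _ P1) => // /s.
Qed.

Lemma suspension_hereditarily_indecomposable : hereditarily_indecomposable R X.
Proof.
move=> K sK; case: (sK) => KX contK.
have [->|KnX] := pselect (K = X); first exact: suspension_indecomposable.
have [ndK|dK] := pselect (Defs.nondegenerate K).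
  have [_ _ _ hK] : is_pseudo_arc R K by exact: proper_is_pseudo_arc.
  by apply: hK; split.
(* A one-point continuum has no nondegenerate subcontinuum. *)
move=> [A1 [A2 [[[AK1 [[z Az] _ _ _]] _ nd] _ _]]].
apply: dK => -[x Kx]; apply: nd; exists x; apply/seteqP; split.
  by move=> w /AK1; rewrite Kx.
move=> _ ->; move: (AK1 _ Az); rewrite Kx => /= <-; exact: Az.
Qed.

End MinimalCantor.

Theorem theorem3p6 (R : realType) (C : pseudoMetricType R) (h : homeo C)
    (Psi : set (R * R)) :
  cantor_like C -> [set: C] !=set0 -> minimal h ->
  Psi `<=` @annulus_int R -> cofrontier Psi -> essential Psi ->
  continuum R (@pseudo_suspension R C h Psi) /\
  (is_pseudo_circle Psi ->
     (forall K, proper_subcontinuum R (@pseudo_suspension R C h Psi) K ->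
                is_pseudo_arc R K) /\
     hereditarily_indecomposable R (@pseudo_suspension R C h Psi)).
Proof.
move=> cC C0 mh iP [cP _] eP; split; first exact: suspension_continuum.
move=> [_ hi cc _]; split; last exact: suspension_hereditarily_indecomposable.
by move=> K; exact: proper_is_pseudo_arc.
Qed.
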